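(* Fix an integer $n\ge 1$. Let $<$ be any linear order on the vertex set of the Legendre polytope $P_n$ satisfying the following three conditions (where $(x,y)$ denotes the vertex $e_y-e_x$): (1) $(x_1,y_1)<(x_2,y_2)$ whenever $x_1-y_1>0>x_2-y_2$; (2) for vertices $(x_1,y_1)\neq(x_2,y_2)$ with $x_1<y_1$ and $x_2<y_2$, we have $(x_1,y_1)<(x_2,y_2)$ whenever the integer interval $\{x_1,x_1+1,\ldots,y_1\}$ is contained in $\{x_2,x_2+1,\ldots,y_2\}$; (3) for vertices $(x_1,y_1)\neq(x_2,y_2)$ with $x_1>y_1$ and $x_2>y_2$, we have $(x_1,y_1)<(x_2,y_2)$ whenever $\{y_1,\ldots,x_1\}$ is contained in $\{y_2,\ldots,x_2\}$. Then the arrow representation is an isomorphism of simplicial complexes between Simion's type $B$ associahedron $\Gamma_n^B$ and the pulling triangulation of the boundary of $P_n$ with respect to $<$: a set $S$ of $B$-diagonals is a face of $\Gamma_n^B$ (i.e. is pairwise noncrossing) if and only if the set of arrows representing the elements of $S$ is the vertex set of a simplex of this pulling triangulation.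
   Context: Label the vertices of a regular $(2n+2)$-gon clockwise by $1,2,\ldots,n+1,\overline{1},\overline{2},\ldots,\overline{n+1}$. A $B$-diagonal is either a diameter $\{i,\overline{i}\}$ with $1\le i\le n+1$, or an antipodal pair of diagonals of the form $\{\{i,j\},\{\overline{i},\overline{j}\}\}$ with $1\le i<i+1<j\le n+1$, or of the form $\{\{i,\overline{j}\},\{\overline{i},j\}\}$ with $1\le j<i\le n+1$. Two $B$-diagonals cross if some diagonal (segment) of one and some diagonal of the other intersect in the interior of the polygon. Simion's type $B$ associahedron $\Gamma_n^B$ is the simplicial complex whose vertices are the $B$-diagonals and whose faces are the sets of pairwise noncrossing $B$-diagonals. The Legendre polytope $P_n\subset\mathbb{R}^{n+1}$ is the convex hull of all $e_j-e_i$ with $i\ne j$ in $\{1,\ldots,n+1\}$ ($e_1,\ldots,e_{n+1}$ the standard basis). The vertex $e_j-e_i$ is written $(i,j)$ and called the arrow from $i$ (its tail) to $j$ (its head). The arrow representation is the following bijection from $B$-diagonals to arrows: $\{i,\overline{i}\}\mapsto(i-1,i)$ for $2\le i\le n+1$ and $\{1,\overline{1}\}\mapsto(n+1,1)$; $\{\{i,j\},\{\overline{i},\overline{j}\}\}\mapsto(j-1,i)$ for $1\le i<i+1<j\le n+1$; $\{\{i,\overline{j}\},\{\overline{i},j\}\}\mapsto(j-1,i)$ for $2\le j<i\le n+1$; $\{\{1,\overline{i}\},\{\overline{1},i\}\}\mapsto(n+1,i)$ for $2\le i\le n+1$. Pulling triangulation (Hudson): for a polytopal complex $\mathcal{P}$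 with a linear order $<$ on its vertex set, $\triangle(\mathcal{P})=\mathcal{P}$ if $\mathcal{P}$ is a single vertex; otherwise, with $v$ the least vertex, $\triangle(\mathcal{P})=\triangle(\mathcal{P}-v)\cup\bigcup_F\{\mathrm{conv}(\{v\}\cup G): G\in\triangle(\mathcal{P}(F))\}$, where $\mathcal{P}-v$ is the complex of faces not containing $v$, $\mathcal{P}(F)$ is the complex of faces contained in $F$, the union runs over the facets $F$ not containing $v$ of the maximal faces of $\mathcal{P}$ containing $v$, and the orders are restricted. This gives a triangulation of $\mathcal{P}$ with no new vertices. Here it is applied to the boundary complex of $P_n$ (all proper faces of $P_n$); simplices are identified with their vertex sets. *)

(* Defs.v *)
From HB Require Import structures.
From mathcomp Require Import all_boot all_order all_algebra.
From mathcomp Require Import all_classical all_reals all_analysis.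

Set Implicit Arguments.
Unset Strict Implicit.
Unset Printing Implicit Defensive.

Import Order.TTheory GRing.Theory Num.Theory.
Import numFieldNormedType.Exports.

Local Open Scope classical_set_scope.
Local Open Scope ring_scope.

Section Polytopes.
Variables (R : realType) (E : lmodType R).
Implicit Types (A P F M : set E) (C : set (set E)) (v w : E).

Definition hull A : set E := smallest (@convex_set R E) A.

(* Faces are cut out by valid linear inequalities [f x <= b].  Taking [f = 0]
   shows that [set0] and [P] are faces of [P]; the empty face is kept
   throughout, so every complex below contains [set0]. *)
Definition face P F : Prop :=
  exists (f : {scalar E}) (b : R),
    (forall x, P x -> f x <= b) /\ F = P `&` [set x | f x = b].

Definition proper_face P F : Prop := face P F /\ F <> P.

Definition facet P F : Prop :=
  proper_face P F /\ forall G, proper_face P G -> F `<=` G -> G = F.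

Definition vertices P : set E := [set v | face P [set v]].

Definition boundary_complex P : set (set E) := [set F | proper_face P F].

Definition complex_vertices C : set E := [set v | C [set v]].

Definition complex_deletion C v : set (set E) := [set F | C F /\ ~ F v].

Definition complex_restriction C F : set (set E) := [set G | C G /\ G `<=` F].

Definition maximal_face C M : Prop :=
  C M /\ forall G, C G -> M `<=` G -> G = M.

Definition strict_linear_order_on A (lt : E -> E -> Prop) : Prop :=
  [/\ forall v, A v -> ~ lt v v,
      forall v w x, A v -> A w -> A x -> lt v w -> lt w x -> lt v x
    & forall v w, A v -> A w -> v <> w -> lt v w \/ lt w v].

Definition least_vertex (lt : E -> E -> Prop) C v : Prop :=
  complex_vertices C v /\
  forall w, complex_vertices C w -> w <> v -> lt v w.

(* [pulling lt C T]: the polytope [T] belongs to the pulling triangulation of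
   [C].  The recursion on the number of vertices is rendered as an inductive
   predicate.  Its base case also covers [C = [set set0]], which occurs when
   the facet [F] in [pulling_cone] is the empty facet of a single vertex. *)
Inductive pulling (lt : E -> E -> Prop) : set (set E) -> set E -> Prop :=
| pulling_base C T :
    (forall v w, complex_vertices C v -> complex_vertices C w -> v = w) ->
    C T -> pulling lt C T
| pulling_deletion C v T :
    least_vertex lt C v ->
    pulling lt (complex_deletion C v) T -> pulling lt C T
| pulling_cone C v M F G :
    least_vertex lt C v ->
    maximal_face C M -> M v -> facet M F -> ~ F v ->
    pulling lt (complex_restriction C F) G ->
    pulling lt C (hull (v |` G)).

End Polytopes.

(* The labels 1, ..., n+1 are shifted to 0, ..., n, the elements of ['I_n.+1].
   The pair [(x, y)] with [x != y] is the arrow with tail [x] and head [y]. *)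
Section Legendre.
Variables (R : realType) (n : nat).

Definition arrow_point (a : 'I_n.+1 * 'I_n.+1) : 'rV[R]_n.+1 :=
  delta_mx 0 a.2 - delta_mx 0 a.1.

Definition legendre_polytope : set 'rV[R]_n.+1 :=
  hull [set arrow_point a | a in [set a | a.1 != a.2]].

End Legendre.

Arguments arrow_point R {n} a.
Arguments legendre_polytope R n : clear implicits.

Definition ord_interval n (x y : 'I_n.+1) : {set 'I_n.+1} :=
  [set k : 'I_n.+1 | (x <= k <= y)%N]%SET.

Section TypeB.
Variables (R : realType) (n : nat).

(* [(i, false)] is the polygon vertex i and [(i, true)] is its antipode. *)
Definition polygon_label : Type := ('I_n.+1 * bool)%type.

Definition label_angle (l : polygon_label) : R :=
  2 * pi * (l.1 + l.2 * n.+1)%N%:R / (2 * n.+1)%N%:R.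

(* The sign makes the labels run clockwise. *)
Definition polygon_point (l : polygon_label) : 'rV[R]_2 :=
  \row_(k < 2) (if k == 0 then cos (label_angle l) else - sin (label_angle l)).

Definition polygon : set 'rV[R]_2 := hull (range polygon_point).

(* [BOpp i j] stands for the pair made of the segment from i to the antipode
   of j and of its antipodal segment.  For [j = 0] and [i = n] these segments
   are two sides of the polygon and not diagonals, so this case is left out. *)
Inductive Bdiagonal : Type :=
| BDiameter (i : 'I_n.+1)
| BSame (i j : 'I_n.+1) of (i.+1 < j)%N
| BOpp (i j : 'I_n.+1) of (j < i)%N && ~~ ((j == 0 :> nat) && (i == n :> nat)).

Definition Bsegments (d : Bdiagonal) : seq (polygon_label * polygon_label) :=
  match d with
  | BDiameter i => [:: ((i, false), (i, true))]
  | BSame i j _ => [:: ((i, false), (j, false)); ((i, true), (j, true))]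
  | BOpp i j _ => [:: ((i, false), (j, true)); ((i, true), (j, false))]
  end.

Definition segment (s : polygon_label * polygon_label) : set 'rV[R]_2 :=
  hull [set polygon_point s.1; polygon_point s.2].

Definition cross (d1 d2 : Bdiagonal) : Prop :=
  exists s1 s2, [/\ s1 \in Bsegments d1, s2 \in Bsegments d2
    & segment s1 `&` segment s2 `&` polygon° !=set0].

(* Distinct B-diagonals only: a B-diagonal meets itself. *)
Definition associahedron_face (S : set Bdiagonal) : Prop :=
  forall d1 d2, S d1 -> S d2 -> d1 <> d2 -> ~ cross d1 d2.

(* [ord_pred] is the cyclic predecessor, so that with 1-based labels the tails
   i - 1 and j - 1 are replaced by n + 1 when i = 1, respectively j = 1. *)
Definition arrow_rep (d : Bdiagonal) : 'I_n.+1 * 'I_n.+1 :=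
  match d with
  | BDiameter i => (ord_pred i, i)
  | BSame i j _ => (ord_pred j, i)
  | BOpp i j _ => (ord_pred j, i)
  end.

End TypeB.

Arguments label_angle R {n} l.
Arguments polygon_point R {n} l.
Arguments polygon R n : clear implicits.
Arguments segment R {n} s.
Arguments cross R {n} d1 d2.
Arguments associahedron_face R {n} S.

(* Main.v *)
(** In a pulling triangulation a set of vertices spans a simplex iff, for every
    final segment U of it in the order <, the smallest face containing U has its
    least vertex in U.  The proper nonempty faces of the Legendre polytope are the
    products I x J of disjoint sets of tails and heads, and the smallest face
    containing a set of arrows is the product of its tails and its heads.  The
    condition on final segments therefore involves only pairs of arrows: (a, b)
    and (c, d) are compatible iff a <> d, c <> b, and neither (a, d) nor (c, b)
    precedes both of them.  For four distinct endpoints the conditions (1)-(3)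
    decide which of the two matchings {(a, b), (c, d)} and {(a, d), (c, b)}
    contains the least of the four arrows, and this turns compatibility into
    linear arithmetic on a, b, c, d, which agrees with the endpoints of the
    corresponding B-diagonals not being interleaved around the polygon.  That
    interleaving is equivalent to crossing follows from the sign of the
    orientation determinant of three points on a circle. *)

Require Import Defs.
From HB Require Import structures.
From mathcomp Require Import all_boot all_order all_algebra.
From mathcomp Require Import all_classical all_reals all_analysis.
From mathcomp Require Import zify ring lra.

Set Implicit Arguments.
Unset Strict Implicit.
Unset Printing Implicit Defensive.

Import Order.TTheory GRing.Theory Num.Theory.
Import numFieldNormedType.Exports.

Local Open Scope classical_set_scope.
Local Open Scope ring_scope.

(** * Convex hulls and their faces *)

Section Hull.
Variables (R : realType) (E : lmodType R).
Implicit Types (A B : set E) (f : {scalar E}).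

Lemma convex_setP A : @convex_set R E A <->
  forall x y (t : R), 0 <= t <= 1 -> A x -> A y -> A (t *: x + (1 - t) *: y).
Proof.
split=> [cA x y t t01 Ax Ay|cA x y l].
  have /(_ _) := cA x y (Itv01 (proj1 (andP t01)) (proj2 (andP t01))).
  by rewrite !inE; apply.
rewrite !inE => Ax Ay; apply: cA => //.
by rewrite ge0 le1.
Qed.

Lemma hull_convex A x y (t : R) :
  0 <= t <= 1 -> hull A x -> hull A y -> hull A (t *: x + (1 - t) *: y).
Proof.
move=> t01 Ax Ay B [cB AB]; have /convex_setP := cB.
by apply=> //; [apply: Ax|apply: Ay].
Qed.

Lemma sub_hull A : A `<=` hull A.
Proof. exact: sub_gen_smallest. Qed.

Lemma hull_min A B : @convex_set R E B -> A `<=` B -> hull A `<=` B.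
Proof. exact: smallest_sub. Qed.

Lemma convex_hull A : @convex_set R E (hull A).
Proof. by apply/convex_setP => *; exact: hull_convex. Qed.

Lemma hullS A B : A `<=` B -> hull A `<=` hull B.
Proof.
move=> AB; apply: hull_min; first exact: convex_hull.
exact: subset_trans AB (@sub_hull B).
Qed.

Lemma hull0 : hull set0 = set0 :> set E.
Proof. by apply/smallest_id/convex_setP. Qed.

Lemma hull1 (v : E) : hull [set v] = [set v].
Proof.
apply/smallest_id/convex_setP => x y t _ -> ->.
by rewrite -scalerDl addrC subrK scale1r.
Qed.

Lemma hullU_hull A B : hull (A `|` hull B) = hull (A `|` B).
Proof.
apply/seteqP; split; last by apply: hullS => x [Ax|/sub_hull]; [left|right].
apply: hull_min; first exact: convex_hull.
move=> x [Ax|]; first by apply: sub_hull; left.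
by apply: hullS => y; right.
Qed.

Lemma hull_le A f (b : R) :
  (forall x, A x -> f x <= b) -> forall x, hull A x -> f x <= b.
Proof.
move=> fA; apply: (@hull_min _ [set x | f x <= b]) => //.
apply/convex_setP => x y t /andP[t0 t1] /= fx fy.
rewrite linearD !linearZ /=; nra.
Qed.

(** The points [y] with [f y <= b] that lie in [hull F] whenever [f y = b] form a convex set
    containing [A]: a proper convex combination reaches the bound only if both ends do. *)
Lemma hull_exposed A f (b : R) : (forall x, A x -> f x <= b) ->
  hull A `&` [set x | f x = b] = hull (A `&` [set x | f x = b]).
Proof.
move=> fA; set F := A `&` _; apply/seteqP; split; last first.
  apply: hull_min; last by move=> x [/sub_hull].
  apply/convex_setP => x y t t01 [hx /= fx] [hy /= fy].
  split; first exact: hull_convex.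
  by rewrite /= linearD !linearZ /= fx fy; ring.
move=> x [hx /= fx].
suff : (fun y => f y <= b /\ (f y = b -> hull F y)) x by case=> _; apply.
apply: (hx [set y | f y <= b /\ (f y = b -> hull F y)]); split; last first.
  by move=> y Ay; split; [apply: fA|move=> fy; apply: sub_hull].
apply/convex_setP => y z t /andP[t0 t1] [fy hy] [fz hz].
split; rewrite linearD !linearZ /=; first by nra.
move=> fyz.
(* At [t = 0] or [t = 1] one of the two points has weight zero and need not reach the bound. *)
have [t_0|tn0] := eqVneq t 0.
  by subst t; rewrite scale0r add0r subr0 scale1r; apply: hz; nra.
have [t_1|tn1] := eqVneq t 1.
  by subst t; rewrite subrr scale0r addr0 scale1r; apply: hy; nra.
have {}t0 : 0 < t by rewrite lt_neqAle eq_sym tn0.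
have {}t1 : t < 1 by rewrite lt_neqAle tn1.
apply: hull_convex; first by rewrite !ltW.
- apply: hy; nra.
- apply: hz; nra.
Qed.

Lemma face_hull A F : face (hull A) F -> exists (f : {scalar E}) (b : R),
  (forall x, A x -> f x <= b) /\ F = hull (A `&` [set x | f x = b]).
Proof.
move=> [f [b [fb ->]]]; exists f, b.
by have fA x (Ax : A x) := fb _ (sub_hull Ax); rewrite hull_exposed.
Qed.

Lemma face_hullP A f (b : R) : (forall x, A x -> f x <= b) ->
  face (hull A) (hull (A `&` [set x | f x = b])).
Proof.
move=> fA; exists f, b; rewrite hull_exposed//; split=> //; exact: hull_le.
Qed.

(** An exposed point is the hull of the generators on its supporting hyperplane. The hull of no
    points is empty, so there is such a generator, and it is the point itself. *)
Lemma vertices_hull_sub A : vertices (hull A) `<=` A.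
Proof.
move=> v /face_hull[f [b [fA Fv]]].
have : hull (A `&` [set x | f x = b]) v by rewrite -Fv.
have [[w [Aw fw]]|/set0P] := pselect ((A `&` [set x | f x = b]) !=set0); last first.
  by move/negP/negPn/eqP => ->; rewrite hull0.
move=> _; have : hull (A `&` [set x | f x = b]) w by apply: sub_hull.
by rewrite -Fv => <-.
Qed.

Lemma vertices_face_sub A B v : B `<=` A -> B v -> vertices A v -> vertices B v.
Proof.
move=> BA Bv [f [b [fA Av]]]; exists f, b; split; first by move=> x /BA /fA.
apply/seteqP; split=> [_ ->|x [Bx fx]].
  by split => //; have [] : (A `&` [set x | f x = b]) v by rewrite -Av.
by rewrite Av; split => //; exact: BA.
Qed.

Lemma hull_segment (p q : E) x : hull [set p; q] x ->
  exists2 t : R, 0 <= t <= 1 & x = t *: p + (1 - t) *: q.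
Proof.
apply: (@hull_min _ [set x | exists2 t : R, 0 <= t <= 1 & x = t *: p + (1 - t) *: q]).
  apply/convex_setP => {}x y t /andP[t0 t1] [a /andP[a0 a1] ->] [b /andP[b0 b1] ->].
  exists (t * a + (1 - t) * b); first by nra.
  rewrite !scalerDr !scalerA addrACA -!scalerDl; congr (_ *: _ + _ *: _); ring.
move=> y [->|->]; [exists 1|exists 0]; rewrite ?lexx ?ler01 //.
  by rewrite subrr scale0r addr0 scale1r.
by rewrite subr0 scale0r add0r scale1r.
Qed.

Lemma hull_conic2 A p q (a b : R) :
  0 <= a -> 0 <= b -> 0 < a + b -> hull A p -> hull A q ->
  hull A ((a + b)^-1 *: (a *: p + b *: q)).
Proof.
move=> a0 b0 ab hp hq.
have -> : (a + b)^-1 *: (a *: p + b *: q) =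
          (a / (a + b)) *: p + (1 - a / (a + b)) *: q.
  rewrite scalerDr !scalerA; congr (_ *: _ + _ *: _); field; lra.
by apply: hull_convex => //; rewrite divr_ge0 ?(ltW ab) //= ler_pdivrMr // mul1r lerDl.
Qed.

Lemma hull_conic4 A p q r s (a b c d : R) :
  0 < a -> 0 < b -> 0 < c -> 0 < d -> a + b + c + d = 1 ->
  hull A p -> hull A q -> hull A r -> hull A s ->
  hull A (a *: p + b *: q + c *: r + d *: s).
Proof.
move=> a0 b0 c0 d0 abcd hp hq hr hs.
have ab0 : a + b != 0 by lra.
have cd0 : c + d != 0 by lra.
have -> : a *: p + b *: q + c *: r + d *: s =
  (a + b) *: ((a + b)^-1 *: (a *: p + b *: q)) +
  (1 - (a + b)) *: ((c + d)^-1 *: (c *: r + d *: s)).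
  have -> : 1 - (a + b) = c + d by lra.
  by rewrite !scalerA !mulfV // !scale1r !addrA.
apply: hull_convex; first by apply/andP; split; lra.
- by apply: hull_conic2 => //; lra.
- by apply: hull_conic2 => //; lra.
Qed.

End Hull.

(** * Faces of the Legendre polytope *)

Section DotProduct.
Variables (R : realType) (m : nat).

Definition dotp (u x : 'rV[R]_m) : R := \sum_k u 0 k * x 0 k.

Fact dotp_is_linear u : scalar (dotp u).
Proof.
move=> c x y; rewrite /dotp mulr_sumr -big_split /=.
by apply: eq_bigr => k _; rewrite !mxE; ring.
Qed.

HB.instance Definition _ u := GRing.isLinear.Build R 'rV[R]_m R _ (dotp u) (dotp_is_linear u).

Lemma dotp_delta u k : dotp u (delta_mx 0 k) = u 0 k.
Proof.
rewrite /dotp (bigD1 k) //= mxE !eqxx mulr1 big1 ?addr0 // => i ik.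
by rewrite mxE (negPf ik) andbF mulr0.
Qed.

End DotProduct.

Section LegendreFaces.
Variables (R : realType) (n : nat).
Local Notation T := 'I_n.+1.
Local Notation pt := (@arrow_point R n).
Local Notation P := (legendre_polytope R n).
Implicit Types (I J : {set T}) (X Y G : {set T * T}) (a b : T * T).

Definition cell X : set 'rV[R]_n.+1 := hull [set pt a | a in [set` X]].

Definition box I J : {set T * T} := [set a | (a.1 \in I) && (a.2 \in J)]%SET.

(** Disjointness excludes loops; the empty box accounts for the empty face. *)
Definition is_box X : Prop := exists I J, [disjoint I & J]%B /\ X = box I J.

Lemma box_neq X a : is_box X -> a \in X -> a.1 != a.2.
Proof.
move=> [I [J [dIJ ->]]]; rewrite inE => /andP[aI aJ].
by apply: contraTneq aJ => <-; rewrite (disjointFr dIJ).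
Qed.

Lemma is_box1 a : a.1 != a.2 -> is_box [set a]%SET.
Proof.
move=> a12; exists [set a.1]%SET, [set a.2]%SET; split.
  by rewrite disjoints1 inE.
by apply/setP => -[x y]; rewrite !inE; case: a {a12} => u v; rewrite xpair_eqE.
Qed.

Lemma is_box0 : is_box finset.set0.
Proof.
exists finset.set0, finset.set0; split; first by rewrite -setI_eq0 finset.set0I.
by apply/setP => a; rewrite !inE.
Qed.

(** For disjoint [I] and [J] this functional is $1$ on [J], $-1$ on [I] and $0$ elsewhere, so its
    maximum $2$ over the arrows is attained exactly on [box I J]. *)
Definition box_normal I J : 'rV[R]_n.+1 :=
  \row_k ((k \in J)%:R - (k \in I)%:R).

Lemma box_normalE I J a : dotp (box_normal I J) (pt a) =
  ((a.2 \in J)%:R - (a.2 \in I)%:R) - ((a.1 \in J)%:R - (a.1 \in I)%:R).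
Proof. by rewrite /arrow_point linearB /= !dotp_delta !mxE. Qed.

Lemma box_normal_le I J a : dotp (box_normal I J) (pt a) <= 2.
Proof.
by rewrite box_normalE; do 4![case: (_ \in _) => /=]; lra.
Qed.

Lemma box_normal_eq I J a : [disjoint I & J]%B ->
  (dotp (box_normal I J) (pt a) == 2) = (a \in box I J).
Proof.
move=> dIJ; rewrite box_normalE inE.
have := disjointFr dIJ (x := a.1); have := disjointFr dIJ (x := a.2).
do 4![case: (_ \in _) => /=] => h1 h2;
  try (by have := h1 isT); try (by have := h2 isT);
  by [apply/eqP; lra | apply/negbTE/eqP; lra].
Qed.

Lemma face_box I J (A : set (T * T)) : [disjoint I & J]%B ->
  face (hull (pt @` A)) (hull (pt @` (A `&` [set` box I J]))).
Proof.
move=> dIJ.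
have le2 x : (pt @` A) x -> dotp (box_normal I J) x <= 2.
  by move=> [a _ <-]; exact: box_normal_le.
have := face_hullP le2; congr (face _ (hull _)).
apply/seteqP; split=> [x [[a Aa <-] /= /eqP]|x [a [Aa /= abox] <-]].
  by rewrite box_normal_eq // => abox; exists a.
by split; [exists a|apply/eqP; rewrite box_normal_eq].
Qed.

Lemma cell_arrow X a : is_box X -> cell X (pt a) <-> a \in X.
Proof.
move=> [I [J [dIJ ->]]]; split=> [ha|aX]; last by apply: sub_hull; exists a.
rewrite -box_normal_eq // eq_le box_normal_le /=.
(* [hull_le] bounds from above, so the lower bound $2$ on the cell is obtained from the negated
   functional. *)
have [u uE] : {f : {scalar 'rV[R]_n.+1} | forall x, f x = - dotp (box_normal I J) x}.
  exists (dotp (- box_normal I J)) => x; rewrite /dotp -sumrN.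
  by apply: eq_bigr => k _; rewrite mxE mulNr.
rewrite -lerN2 -uE; apply: hull_le ha => _ [b /= + <-].
by rewrite uE -box_normal_eq // => /eqP->.
Qed.

Lemma cellS X Y : is_box Y -> cell X `<=` cell Y <-> X \subset Y.
Proof.
move=> bY; split=> [XY|/fintype.subsetP XY].
  apply/fintype.subsetP => a aX.
  have /XY/(cell_arrow _ bY) : cell X (pt a) by apply: sub_hull; exists a.
  exact.
by apply: hullS => _ [a /= aX <-]; exists a => //=; exact: XY.
Qed.

Lemma cell_inj X Y : is_box X -> is_box Y -> cell X = cell Y -> X = Y.
Proof.
by move=> bX bY XY; apply/eqP; rewrite finset.eqEsubset; apply/andP; split;
  apply/cellS => //; rewrite XY.
Qed.

Lemma cell1 a : cell [set a]%SET = [set pt a].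
Proof.
rewrite /cell -[RHS]hull1; congr hull; apply/seteqP; split=> [_ [b /= + <-]|_ ->].
  by rewrite inE => /eqP->.
by exists a => //=; rewrite inE.
Qed.

Lemma cell0 : cell finset.set0 = set0.
Proof.
rewrite /cell -[RHS](@hull0 R 'rV[R]_n.+1); congr hull.
by apply/seteqP; split=> // _ [b /= + _]; rewrite inE.
Qed.

Lemma arrow_point_inj a b : a.1 != a.2 -> pt a = pt b -> a = b.
Proof.
move=> a12 ab; have : cell [set a]%SET (pt b) by rewrite cell1 ab.
by move/(cell_arrow _ (is_box1 a12)); rewrite inE => /eqP.
Qed.

Lemma cellI_box X I J : [disjoint I & J]%B ->
  face (cell X) (cell (X :&: box I J)%SET).
Proof.
move=> dIJ; have := @face_box I J [set` X] dIJ; congr (face _ (hull (_ @` _))).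
by apply/seteqP; split=> a /=; rewrite !inE => /andP.
Qed.

(** A functional is a potential [phi] on the indices, with value [phi a.2 - phi a.1] on the arrow
    [a]. Once some arrow attains the bound, those attaining it have tails minimizing [phi] on [I]
    and heads maximizing it on [J], which is again a box. *)
Lemma face_cell X F : is_box X -> face (cell X) F ->
  exists Y, [/\ is_box Y, Y \subset X & F = cell Y].
Proof.
move=> bX /face_hull[f [c [fc ->]]].
have [[_ [[s sX <-] /= fs]]|/set0P] := pselect ((pt @` [set` X] `&` [set x | f x = c]) !=set0);
    last first.
  move/negP/negPn/eqP => ->; exists finset.set0.
  by rewrite finset.sub0set hull0 cell0; split=> //; exact: is_box0.
case: bX sX fc => I [J [dIJ ->]] /=; rewrite inE => /andP[sI sJ] fc.
pose phi k := f (delta_mx 0 k : 'rV[R]_n.+1).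
have fE a : f (pt a) = phi a.2 - phi a.1 by rewrite /arrow_point linearB.
have fle i j : i \in I -> j \in J -> phi j - phi i <= c.
  by move=> iI jJ; rewrite -(fE (i, j)); apply: fc; exists (i, j) => //=; rewrite inE iI.
have Jle j : j \in J -> phi j <= phi s.2.
  by move=> jJ; have := fle _ _ sI jJ; rewrite -fs fE; lra.
have Ige i : i \in I -> phi s.1 <= phi i.
  by move=> iI; have := fle _ _ iI sJ; rewrite -fs fE; lra.
pose I' := [set i in I | phi i == phi s.1]%SET.
pose J' := [set j in J | phi j == phi s.2]%SET.
exists (box I' J'); split.
- exists I', J'; split=> //; apply: disjointWl (disjointWr _ dIJ);
    by apply/fintype.subsetP => i; rewrite inE => /andP[].
- by apply/fintype.subsetP => a; rewrite !inE => /andP[/andP[-> _] /andP[->]].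
congr hull; apply/seteqP; split=> [_ [[a /= + <-]]|_ [a /= + <-]]; rewrite !inE.
  move=> /andP[aI aJ]; rewrite -fs !fE => fa; exists a => //=; rewrite !inE aI aJ /=.
  by have := Ige _ aI; have := Jle _ aJ => ? ?; apply/andP; split; apply/eqP; lra.
move=> /andP[/andP[aI /eqP a1] /andP[aJ /eqP a2]]; split.
  by exists a => //=; rewrite inE aI.
by rewrite /= -fs !fE a1 a2.
Qed.

Lemma polytope_arrow a : a.1 != a.2 -> P (pt a).
Proof. by move=> a12; apply: sub_hull; exists a. Qed.

(** The potential argument of [face_cell] with all indices allowed as tails and heads. Here
    disjointness comes from properness, which makes the bound [c] positive and so separates the
    minimum of [phi] from its maximum. *)
Lemma proper_face_polytope F : proper_face P F -> exists2 X, is_box X & F = cell X.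
Proof.
move=> [/face_hull[f [c [fc ->]]] FP].
have [[_ [[s /= s12 <-] /= fs]]|/set0P] := pselect
    ((pt @` [set a | a.1 != a.2] `&` [set x | f x = c]) !=set0); last first.
  move/negP/negPn/eqP => ->; exists finset.set0; last by rewrite hull0 cell0.
  exact: is_box0.
pose phi k := f (delta_mx 0 k : 'rV[R]_n.+1).
have fE a : f (pt a) = phi a.2 - phi a.1 by rewrite /arrow_point linearB.
have fle i j : i != j -> phi j - phi i <= c.
  by move=> ij; rewrite -(fE (i, j)); apply: fc; exists (i, j).
(* An arrow and its reverse have opposite values, so [c >= 0], and [c = 0] would put every arrow on
   the hyperplane. *)
have c_gt0 : 0 < c.
  rewrite lt_neqAle; apply/andP; split; last first.
    have := fle _ _ s12; have := fle s.2 s.1; rewrite eq_sym => /(_ s12).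
    by move: fs; rewrite fE; lra.
  apply/eqP => c0; apply: FP; congr hull; apply/seteqP; split=> [x []//|_ [a /= a12 <-]].
  split; first by exists a.
  have := fle _ _ a12; have := fle a.2 a.1; rewrite eq_sym => /(_ a12).
  by rewrite /= fE; lra.
have Jle j : phi j <= phi s.2.
  have [->|js] := eqVneq j s.1; first by move: fs; rewrite fE; lra.
  by have := fle s.1 j; rewrite eq_sym => /(_ js); rewrite -fs fE; lra.
have Ige i : phi s.1 <= phi i.
  have [->|js] := eqVneq i s.2; first by move: fs; rewrite fE; lra.
  by have := fle i s.2 js; rewrite -fs fE; lra.
pose I' := [set i | phi i == phi s.1]%SET.
pose J' := [set j | phi j == phi s.2]%SET.
have dIJ : [disjoint I' & J']%B.
  rewrite -setI_eq0; apply/eqP/setP => i; rewrite !inE; apply/negbTE/negP.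
  by move=> /andP[/eqP i1 /eqP i2]; move: fs; rewrite fE; lra.
have bIJ : is_box (box I' J') by exists I', J'.
exists (box I' J') => //.
congr hull; apply/seteqP; split=> [_ [[a /= a12 <-]]|_ [a /= aX <-]].
  rewrite -fs !fE => fa; exists a => //=; rewrite !inE.
  by have := Ige a.1; have := Jle a.2 => ? ?; apply/andP; split; apply/eqP; lra.
split; first by exists a => //; exact: box_neq aX.
by move: aX; rewrite !inE /= -fs !fE => /andP[/eqP-> /eqP->].
Qed.

Lemma face_polytope X : is_box X -> face P (cell X).
Proof.
move=> bX; have [I [J [dIJ XE]]] := bX.
have := @face_box I J [set a | a.1 != a.2] dIJ.
congr (face _ (hull (_ @` _))); rewrite -XE; apply/seteqP; split=> [a []//|a /= aX].
by split=> //; exact: box_neq aX.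
Qed.

Lemma vertices_polytope : vertices P = pt @` [set a | a.1 != a.2].
Proof.
apply/seteqP; split; first exact: vertices_hull_sub.
by move=> _ [a a12 <-]; rewrite /vertices /= -cell1; apply/face_polytope/is_box1.
Qed.

Lemma vertices_cell X G : is_box X -> G \subset X -> vertices (cell G) = pt @` [set` G].
Proof.
move=> bX /fintype.subsetP GX; apply/seteqP; split; first exact: vertices_hull_sub.
move=> _ [a /= aG <-]; have a12 := box_neq bX (GX _ aG).
apply: (@vertices_face_sub _ _ P); last by rewrite vertices_polytope; exists a.
- by apply: hullS => _ [b /= bG <-]; exists b => //; exact: box_neq (GX _ bG).
- by apply: sub_hull; exists a.
Qed.

Lemma boundary_polytope : (1 <= n)%N -> boundary_complex P = cell @` is_box.
Proof.
move=> n1; apply/seteqP; split=> [F /proper_face_polytope[X bX ->]|_ [X bX <-]].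
  by exists X.
split; first exact: face_polytope.
(* The polytope contains an arrow together with its reverse, which no box does. *)
move=> XP; have n01 : (0 : T) != ord_max by rewrite -val_eqE /=; lia.
have /(cell_arrow _ bX) h01 : cell X (pt (0, ord_max)) by rewrite XP; exact: polytope_arrow.
have /(cell_arrow _ bX) h10 : cell X (pt (ord_max, 0)).
  by rewrite XP; apply: polytope_arrow; rewrite eq_sym.
case: bX h01 h10 => I [J [dIJ ->]]; rewrite !inE /= => /andP[I0 _] /andP[_ J0].
by move: (disjointFr dIJ I0); rewrite J0.
Qed.

End LegendreFaces.

(** * Boxes of arrows and their facets *)

Section Boxes.
Variable n : nat.
Local Notation T := 'I_n.+1.
Implicit Types (I J : {set T}) (X Y G : {set T * T}) (a b : T * T).

Definition tails G : {set T} := [set b.1 | b in G]%SET.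
Definition heads G : {set T} := [set b.2 | b in G]%SET.

(* The smallest box containing [G], that is, the smallest face through the
   arrows of [G]. *)
Definition carrier G := box (tails G) (heads G).

Lemma sub_carrier G : G \subset carrier G.
Proof. by apply/fintype.subsetP => b bH; rewrite inE !imset_f. Qed.

Lemma carrier_min G X : is_box X -> G \subset X -> carrier G \subset X.
Proof.
move=> [I [J [_ ->]]] /fintype.subsetP GX; apply/fintype.subsetP => b.
rewrite !inE => /andP[/imsetP[c cG ->] /imsetP[d dG ->]].
by move: (GX _ cG) (GX _ dG); rewrite !inE => /andP[-> _] /andP[_ ->].
Qed.

Lemma carrier_is_box G X : is_box X -> G \subset X -> is_box (carrier G).
Proof.
move=> [I [J [dIJ ->]]] /fintype.subsetP GX; exists (tails G), (heads G); split=> //.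
by apply: disjointWl (disjointWr _ dIJ); apply/fintype.subsetP => _ /imsetP[b bG ->];
  have := GX _ bG; rewrite inE => /andP[].
Qed.

Lemma box_mix X a b : is_box X -> a \in X -> b \in X -> (a.1, b.2) \in X.
Proof. by case=> I [J [_ ->]]; rewrite !inE /= => /andP[-> _] /andP[_ ->]. Qed.

(** Either the tail of [a] is not a tail of [G] or its head is not a head of [G]. Removing that
    index from its factor of the box gives the facet, as long as the factor has another element;
    when both factors are singletons, the facet is empty. *)
Lemma facet_box_avoiding X G a : is_box X -> a \in X -> G \subset X -> a \notin carrier G ->
  exists F, [/\ is_box F, F \subset X, G \subset F, a \notin F
    & forall Y, is_box Y -> Y \subset X -> Y != X -> F \subset Y -> Y = F].
Proof.
move=> bX; have [I [J [dIJ XE]]] := bX; rewrite XE inE => /andP[aI aJ] GX aG.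
have dropI i0 : i0 \in I -> i0 != a.1 -> a.1 \notin tails G ->
  exists F, [/\ is_box F, F \subset box I J, G \subset F, a \notin F
    & forall Y, is_box Y -> Y \subset box I J -> Y != box I J -> F \subset Y -> Y = F].
  move=> i0I i0a aG1; exists (box (I :\ a.1)%SET J); split.
  - exists (I :\ a.1)%SET, J; split=> //; apply: disjointWl dIJ; exact: subD1set.
  - by apply/fintype.subsetP => b; rewrite !inE => /andP[/andP[_ ->] ->].
  - apply/fintype.subsetP => b bG; have := fintype.subsetP GX _ bG.
    rewrite !inE => /andP[-> ->]; rewrite !andbT.
    by apply: contraNneq aG1 => <-; exact: imset_f.
  - by rewrite !inE eqxx.
  move=> Y bY /fintype.subsetP YX YneX /fintype.subsetP FY.
  (* The spare tail [i0] makes every head of [J] a head of [Y]; one arrow of [Y] with tail [a.1]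
     then gives all of [box I J] by mixing. *)
  have i0Y j : j \in J -> (i0, j) \in Y by move=> jJ; apply: FY; rewrite !inE i0a i0I.
  apply/setP => b; apply/idP/idP => [bY'|/FY//].
  have := YX _ bY'; rewrite !inE => /andP[b1 b2]; rewrite b1 b2 !andbT.
  apply: contraNneq YneX => ba; apply/eqP/setP => c; apply/idP/idP => [/YX//|].
  rewrite inE => /andP[cI cJ]; have [ca|ca] := eqVneq c.1 a.1.
    by have := box_mix bY bY' (i0Y _ cJ); rewrite /= ba -ca -surjective_pairing.
  by apply: FY; rewrite !inE ca cI.
have dropJ j0 : j0 \in J -> j0 != a.2 -> a.2 \notin heads G ->
  exists F, [/\ is_box F, F \subset box I J, G \subset F, a \notin F
    & forall Y, is_box Y -> Y \subset box I J -> Y != box I J -> F \subset Y -> Y = F].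
  move=> j0J j0a aG2; exists (box I (J :\ a.2)%SET); split.
  - exists I, (J :\ a.2)%SET; split=> //; apply: disjointWr dIJ; exact: subD1set.
  - by apply/fintype.subsetP => b; rewrite !inE => /andP[-> /andP[_ ->]].
  - apply/fintype.subsetP => b bG; have := fintype.subsetP GX _ bG.
    rewrite !inE => /andP[-> ->]; rewrite !andbT /=.
    by apply: contraNneq aG2 => <-; exact: imset_f.
  - by rewrite !inE eqxx /= andbF.
  move=> Y bY /fintype.subsetP YX YneX /fintype.subsetP FY.
  have j0Y i : i \in I -> (i, j0) \in Y by move=> iI; apply: FY; rewrite !inE j0a j0J iI.
  apply/setP => b; apply/idP/idP => [bY'|/FY//].
  have := YX _ bY'; rewrite !inE => /andP[b1 b2]; rewrite b1 b2 !andbT /=.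
  apply: contraNneq YneX => ba; apply/eqP/setP => c; apply/idP/idP => [/YX//|].
  rewrite inE => /andP[cI cJ]; have [ca|ca] := eqVneq c.2 a.2.
    by have := box_mix bY (j0Y _ cI) bY'; rewrite /= ba -ca -surjective_pairing.
  by apply: FY; rewrite !inE ca cI cJ.
have [/existsP[i0 /andP[i0I i0a]]|/existsPn noI] :=
    boolP [exists i, (i \in I) && (i != a.1)].
  have [aG1|/(dropI _ i0I i0a)//] := boolP (a.1 \in tails G).
  have aG2 : a.2 \notin heads G by apply: contra aG => aG2; rewrite inE aG1.
  have [/existsP[j0 /andP[j0J j0a]]|/existsPn noJ] :=
      boolP [exists j, (j \in J) && (j != a.2)].
    exact: (dropJ j0).
  exfalso; case/imsetP: aG1 => b bG _; have := fintype.subsetP GX _ bG; rewrite inE.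
  move=> /andP[_ bJ]; have := noJ b.2; rewrite bJ /= negbK => /eqP ba.
  by case/negP: aG2; rewrite -ba; exact: imset_f.
have I1 b : b \in box I J -> b.1 = a.1.
  by rewrite inE => /andP[bI _]; have := noI b.1; rewrite bI /= negbK => /eqP.
have aG2 : a.2 \notin heads G.
  apply: contra aG => /imsetP[b bG ab]; rewrite inE ab; apply/andP.
  split; last exact: imset_f.
  by rewrite -(I1 b); [exact: imset_f|exact: fintype.subsetP GX _ bG].
have [/existsP[j0 /andP[j0J j0a]]|/existsPn noJ] :=
    boolP [exists j, (j \in J) && (j != a.2)].
  exact: (dropJ j0).
(* The box is the single arrow [a], so [G] is empty. *)
have X1 b : b \in box I J -> b = a.
  move=> bX'; have := I1 _ bX'; move: bX'; rewrite inE => /andP[_ bJ].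
  have := noJ b.2; rewrite bJ /= negbK => /eqP.
  by case: (a) (b) => [? ?] [? ?] /= -> ->.
exists finset.set0; split; rewrite ?finset.sub0set ?inE //; first exact: is_box0.
  apply/fintype.subsetP => b bG; case/negP: aG2.
  by rewrite -(X1 b); [exact: imset_f|exact: fintype.subsetP GX _ bG].
move=> Y bY /fintype.subsetP YX YneX _; apply/setP => b; rewrite inE; apply/negP => bY'.
case/negP: YneX; apply/eqP/setP => c; apply/idP/idP => [/YX//|/X1->].
by rewrite -(X1 b) //; exact: YX.
Qed.

End Boxes.

(** * Pulling triangulations of complexes of faces *)

Section PullingCells.
Variables (R : realType) (n : nat).
Local Notation T := 'I_n.+1.
Local Notation pt := (@arrow_point R n).
Local Notation P := (legendre_polytope R n).
Variable lt : 'rV[R]_n.+1 -> 'rV[R]_n.+1 -> Prop.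
Hypothesis lt_order : strict_linear_order_on (vertices P) lt.
Implicit Types (X Y G : {set T * T}) (a b : T * T) (D : set {set T * T}).

Local Notation ltp a b := (lt (pt a) (pt b)).

Lemma ltp_irr a : a.1 != a.2 -> ~ ltp a a.
Proof.
by move=> a12; case: lt_order => irr _ _; apply: irr; rewrite vertices_polytope; exists a.
Qed.

Lemma ltp_trans a b c : a.1 != a.2 -> b.1 != b.2 -> c.1 != c.2 ->
  ltp a b -> ltp b c -> ltp a c.
Proof.
by move=> a12 b12 c12; case: lt_order => _ tr _; apply: tr;
  rewrite vertices_polytope; [exists a|exists b|exists c].
Qed.

Lemma ltp_total a b : a.1 != a.2 -> b.1 != b.2 -> a <> b -> ltp a b \/ ltp b a.
Proof.
move=> a12 b12 ab; case: lt_order => _ _; apply; rewrite ?vertices_polytope.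
- by exists a.
- by exists b.
- by move/(arrow_point_inj a12).
Qed.

(* Flagness: membership of [G] in the pulling triangulation only involves
   pairs of arrows. *)
Definition stable G : Prop :=
  forall a b, a \in G -> b \in G -> ~ (ltp (a.1, b.2) a /\ ltp (a.1, b.2) b).

(** Under [cell] such families become complexes of faces; deletions and restrictions stay among
    them, so the recursion of [pulling] can be followed on sets of arrows. *)
Definition box_complex D : Prop :=
  (forall X, D X -> is_box X) /\
  (forall X Y, D X -> is_box Y -> Y \subset X -> D Y).

Definition deletion D a : set {set T * T} := [set X | D X /\ a \notin X].

Definition restriction D Y : set {set T * T} := [set X | D X /\ X \subset Y].

Local Notation cells D := (@cell R n @` D).

Lemma box_complex_deletion D a : box_complex D -> box_complex (deletion D a).
Proof.
move=> [Dbox Ddown]; split=> [X [/Dbox]//|X Y [DX aX] bY YX].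
split; first exact: Ddown DX bY YX.
by apply: contra aX; apply: (fintype.subsetP YX).
Qed.

Lemma box_complex_restriction D Y : box_complex D -> box_complex (restriction D Y).
Proof.
move=> [Dbox Ddown]; split=> [X [/Dbox]//|X Z [DX XY] bZ ZX].
by split; [exact: Ddown DX bZ ZX|exact: fintype.subset_trans ZX XY].
Qed.

Lemma complex_deletion_cells D a : box_complex D ->
  complex_deletion (cells D) (pt a) = cells (deletion D a).
Proof.
move=> [Dbox _]; apply/seteqP; split=> [_ [[X DX <-] aX]|_ [X [DX aX] <-]].
  exists X => //; split=> //; apply/negP => aX'.
  by apply: aX; apply/(cell_arrow _ _ (Dbox _ DX)).
split; first by exists X.
by move/(cell_arrow _ _ (Dbox _ DX)); apply/negP.
Qed.

Lemma complex_restriction_cells D Y : box_complex D -> is_box Y ->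
  complex_restriction (cells D) (@cell R n Y) = cells (restriction D Y).
Proof.
move=> [Dbox _] bY; apply/seteqP; split=> [_ [[X DX <-] XY]|_ [X [DX XY] <-]].
  by exists X => //; split=> //; apply/(cellS R).
by split; [exists X|apply/(cellS R)].
Qed.

Lemma complex_vertices_cells D v : box_complex D ->
  complex_vertices (cells D) v <-> exists2 a, D [set a]%SET & v = pt a.
Proof.
move=> [Dbox Ddown]; split=> [[X DX Xv]|[a Da ->]]; last first.
  by exists [set a]%SET => //; rewrite cell1.
have [X0|[a aX]] := set_0Vmem X.
  by have : [set v] v by []; rewrite -Xv X0 cell0.
have va : v = pt a.
  by have : @cell R n X (pt a) by [apply/cell_arrow => //; exact: Dbox]; rewrite Xv.
exists a => //; apply: (Ddown _ _ DX); last by rewrite finset.sub1set.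
by apply/is_box1/(box_neq (Dbox _ DX)).
Qed.

Lemma box_complex1 D a : box_complex D -> D [set a]%SET -> a.1 != a.2.
Proof. by move=> [Dbox _] /Dbox/box_neq; apply; rewrite inE. Qed.

Lemma least_vertex_cells D a : box_complex D ->
  least_vertex lt (cells D) (pt a) -> forall b, D [set b]%SET -> b <> a -> ltp a b.
Proof.
move=> DB [_ least] b Db ba; apply: least.
  by apply/complex_vertices_cells => //; exists b.
by move/(arrow_point_inj (box_complex1 DB Db)).
Qed.

(** Induction on the derivation. In a cone step the apex is the least vertex of the maximal face, so
    no arrow of [X] precedes it and no pair containing it violates stability; the other pairs are
    covered by induction. *)
Lemma stable_of_pulling D S : box_complex D -> pulling lt (cells D) S ->
  exists X G, [/\ D X, G \subset X, stable G & S = @cell R n G].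
Proof.
move=> DB DS; move: {-2}(cells D) (erefl (cells D)) DS => C CE DS.
elim: DS D DB CE => {C S} [C S v1 CS|C v S least _ IH|
  C v M F S least CM Mv [[faceF _] _] Fv _ IH] D DB CD; subst C.
- have [X DX <-] := CS.
  exists X, X; split=> // a b aX bX.
  have Xin c (cX : c \in X) : complex_vertices (cells D) (pt c).
    apply/complex_vertices_cells => //; exists c => //; apply: (DB.2 _ _ DX).
      by apply/is_box1/(box_neq (DB.1 _ DX)).
    by rewrite finset.sub1set.
  have <- : a = b by apply: (arrow_point_inj (box_neq (DB.1 _ DX) aX)); apply: v1; exact: Xin.
  rewrite -surjective_pairing => -[aa _]; apply: ltp_irr aa.
  exact: box_neq (DB.1 _ DX) aX.
- have [/complex_vertices_cells -/(_ DB)[a Da va] _] := least.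
  have [|X [G [[DX aX] GX sG SG]]] := IH _ (box_complex_deletion a DB).
    by rewrite va complex_deletion_cells.
  by exists X, G.
have [[X DX XM] _] := CM.
have bX := DB.1 _ DX.
have [/complex_vertices_cells -/(_ DB)[a Da va] _] := least.
move: faceF Mv; rewrite -XM va => /(face_cell bX)[Y [bY YX FY]] /(cell_arrow _ _ bX) aX.
have [|Z [G [[DZ ZY] GZ sG SG]]] := IH _ (box_complex_restriction Y DB).
  by rewrite FY complex_restriction_cells.
have GX : a |: G \subset X.
  rewrite finset.subUset finset.sub1set aX /=.
  exact: fintype.subset_trans (fintype.subset_trans GZ ZY) YX.
exists X, (a |: G)%SET; split=> //.
  have leastX b : b \in X -> b <> a -> ltp a b.
    move=> bX' ba; apply: (least_vertex_cells DB) ba; first by rewrite -va.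
    apply: (DB.2 _ _ DX); last by rewrite finset.sub1set.
    by apply/is_box1/(box_neq bX).
  have nlt b : b \in X -> ~ ltp b a.
    move=> bX' ba; have [ab|/eqP/leastX -/(_ bX') ab] := eqVneq b a.
      by move: ba; rewrite ab; apply/ltp_irr/(box_neq bX).
    have b12 := box_neq bX bX'; have a12 := box_neq bX aX.
    by apply: (ltp_irr a12); exact: ltp_trans ab ba.
  move=> b c bG cG [lb lc]; have bX' := fintype.subsetP GX _ bG.
  have cX' := fintype.subsetP GX _ cG; have bcX := box_mix bX bX' cX'.
  move: bG cG; rewrite !inE => /orP[/eqP ba|bG].
    by move=> _; apply: (nlt _ bcX); rewrite -ba.
  move=> /orP[/eqP ca|cG]; first by apply: (nlt _ bcX); rewrite -ca.
  exact: sG bG cG _.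
rewrite SG /cell hullU_hull; congr hull; apply/seteqP; split=> [x [->|[b bG <-]]|].
- by exists a => //=; rewrite !inE eqxx.
- by exists b => //=; rewrite !inE bG orbT.
move=> _ [b /= + <-]; rewrite !inE => /orP[/eqP->|bG]; first by left.
by right; exists b.
Qed.

Lemma least_arrow (A : {set T * T}) : (forall a, a \in A -> a.1 != a.2) ->
  A != finset.set0 ->
  exists2 a, a \in A & forall b, b \in A -> b <> a -> ltp a b.
Proof.
have [m] := ubnP #|A|; elim: m A => // m IH A Am Aneq /set0Pn[a aA].
have [A0|A0] := eqVneq (A :\ a)%SET finset.set0.
  exists a => // b bA /eqP ba.
  by have : b \in (A :\ a)%SET; [rewrite !inE ba|rewrite A0 inE].
have [||//|c] := IH (A :\ a)%SET.
- by rewrite (cardsD1 a A) aA in Am.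
- by move=> b; rewrite !inE => /andP[_ /Aneq].
rewrite !inE => /andP[/eqP ca cA] least.
have [ac|ca'] := ltp_total (Aneq _ aA) (Aneq _ cA) (nesym ca).
  exists a => // b bA /eqP ba; have [->//|/eqP bc] := eqVneq b c.
  apply: (ltp_trans (Aneq _ aA) (Aneq _ cA) (Aneq _ bA) ac).
  by apply: least bc; rewrite !inE ba.
exists c => // b bA bc; have [->//|ba] := eqVneq b a.
by apply: least bc; rewrite !inE ba.
Qed.

(** Induction on the number of vertices, with [a] the least one. If a face of [D] contains [G] and
    avoids [a], then [a] is deleted. Otherwise [a] belongs to [G], and the rest of [G] lies in a
    facet, avoiding [a], of a maximal face through [a]. *)
Lemma pulling_of_stable D X G : box_complex D -> D X -> G \subset X -> stable G ->
  pulling lt (cells D) (@cell R n G).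
Proof.
move=> DB; pose V D := [set a | `[< D [set a]%SET >]]%SET.
have [m] := ubnP #|V D|; elim: m D X G DB => // m IH D X G DB VDm DX GX sG.
have bX := DB.1 _ DX.
have [V1|Vn1] := pselect (forall a b, D [set a]%SET -> D [set b]%SET -> a = b).
  apply: pulling_base => [v w|].
    move=> /(complex_vertices_cells _ DB)[a Da ->] /(complex_vertices_cells _ DB)[b Db ->].
    by rewrite (V1 a b).
  (* With at most one vertex in [D], the set [G] is empty or a single arrow, hence itself a box. *)
  exists G => //; apply: (DB.2 _ _ DX _ GX).
  have [->|[a aG]] := set_0Vmem G; first exact: is_box0.
  suff -> : G = [set a]%SET by apply/is_box1/(box_neq bX)/(fintype.subsetP GX).
  have D1 b : b \in G -> D [set b]%SET.
    move=> /(fintype.subsetP GX) bX'; apply: (DB.2 _ _ DX).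
      by apply/is_box1/(box_neq bX).
    by rewrite finset.sub1set.
  apply/setP => b; rewrite inE; apply/idP/eqP => [bG|->//].
  by apply: V1; exact: D1.
have Vneq a : a \in V D -> a.1 != a.2.
  by rewrite inE => /asboolP; exact: box_complex1.
have [a aV leasta] : exists2 a, a \in V D & forall b, b \in V D -> b <> a -> ltp a b.
  apply: least_arrow => //; apply/eqP => V0; apply: Vn1 => a b Da.
  by have : a \in V D; [rewrite inE; apply/asboolP|rewrite V0 inE].
have Da : D [set a]%SET by move: aV; rewrite inE => /asboolP.
have a12 := Vneq _ aV.
have least : least_vertex lt (cells D) (pt a).
  split; first by apply/(complex_vertices_cells _ DB); exists a.
  move=> w /(complex_vertices_cells _ DB)[b Db ->] ba.
  by apply: leasta => [|ba']; [rewrite inE; apply/asboolP|rewrite ba' in ba].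
have VS D' : (forall Y, D' Y -> D Y) -> ~ D' [set a]%SET -> (#|V D'| < m)%N.
  move=> D'D D'a; apply: (@leq_trans #|V D|); last by rewrite -ltnS.
  apply: proper_card; apply/properP.
  split; first by apply/fintype.subsetP => b; rewrite !inE; exact: D'D.
  by exists a => //; rewrite inE; apply/asboolP.
have [[Y [DY GY aY]]|noY] := pselect (exists Y, [/\ D Y, G \subset Y & a \notin Y]).
  apply: (pulling_deletion least); rewrite (complex_deletion_cells _ DB).
  apply: (IH _ Y) => //; first exact: box_complex_deletion.
  by apply: VS => [Z []//|[_]]; rewrite inE eqxx.
(* An arrow of the carrier has its tail from some [b] and its head from some [c] in [H]. If both
   differ from [a], then [a] precedes both, against stability. *)
have in_carrier (H : {set T * T}) : H \subset G -> a \in carrier H -> a \in H.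
  move=> HG; rewrite inE => /andP[/imsetP[b bH a1] /imsetP[c cH a2]].
  have bG := fintype.subsetP HG _ bH; have cG := fintype.subsetP HG _ cH.
  have Va d : d \in G -> d \in V D.
    move=> /(fintype.subsetP GX) dX; rewrite inE; apply/asboolP; apply: (DB.2 _ _ DX).
      by apply/is_box1/(box_neq bX).
    by rewrite finset.sub1set.
  have [ab|/eqP ba] := eqVneq b a; first by rewrite -ab.
  have [ac|/eqP ca] := eqVneq c a; first by rewrite -ac.
  case: (sG _ _ bG cG); rewrite -a1 -a2 -surjective_pairing.
  by split; apply: leasta => //; exact: Va.
(* Otherwise the carrier of [G] is a face of [D] that contains [G] and avoids [a]. *)
have aG : a \in G.
  apply: in_carrier => //; apply/negPn/negP => aC; apply: noY.
  exists (carrier G); split=> //; last exact: sub_carrier.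
  by apply: (DB.2 _ _ DX); [exact: carrier_is_box GX|exact: carrier_min].
pose G' := (G :\ a)%SET.
have G'G : G' \subset G by exact: subD1set.
have G'X := fintype.subset_trans G'G GX.
have aG' : a \notin carrier G'.
  by apply/negP => /(in_carrier _ G'G); rewrite !inE eqxx.
have [M /maxsetP[/asboolP DM Mmax] XM] :=
  @maxset_exists _ (fun Y => `[< D Y >]) _ (asboolT DX).
have bM := DB.1 _ DM.
have aM : a \in M by apply/(fintype.subsetP XM)/(fintype.subsetP GX).
have [F [bF FM G'F aF Fmax]] :=
  facet_box_avoiding bM aM (fintype.subset_trans G'X XM) aG'.
have -> : @cell R n G = hull (pt a |` @cell R n G').
  rewrite /cell hullU_hull; congr hull; apply/seteqP; split=> [_ [b /= bG <-]|x].
    have [->|ba] := eqVneq b a; first by left.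
    by right; exists b => //=; rewrite !inE ba.
  by move=> [->|[b /= + <-]]; [exists a|rewrite !inE => /andP[_ bG]; exists b].
apply: (@pulling_cone _ _ _ _ _ (@cell R n M) (@cell R n F)) => //.
- split; first by exists M.
  move=> _ [Y DY <-] /(cellS _ _ (DB.1 _ DY)) MY.
  by rewrite (Mmax Y) //; exact/asboolP.
- exact/cell_arrow.
- split; first split.
  + case: (bF) => I [J [dIJ FE]].
    have : face (@cell R n M) (@cell R n (M :&: box I J)%SET) by exact: cellI_box.
    by rewrite -FE; congr (face _ (cell _)); apply/finset.setIidPr.
  + by move/(cell_inj bF bM) => FM'; move: aF; rewrite FM' aM.
  + move=> _ [/(face_cell bM)[Y [bY YM ->]] YM'] /(cellS _ _ bY) FY.
    by rewrite (Fmax Y) //; apply: contra_notN YM' => /eqP->.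
- by move/(cell_arrow _ _ bF); apply/negP.
rewrite (complex_restriction_cells DB bF); apply: (IH _ F) => //.
- exact: box_complex_restriction.
- by apply: VS => [Z []//|[_]]; rewrite finset.sub1set; apply/negP.
- by split=> //; exact: (DB.2 _ _ DM).
- move=> b c bG' cG'; apply: sG; exact: (fintype.subsetP G'G).
Qed.

End PullingCells.

(** * Interleaving of chords and comparison of arrows *)

Section ArrowCombinatorics.
Local Open Scope nat_scope.

(* The comparisons of arrows imposed by conditions (1), (2) and (3). *)
Definition forced_lt (a b : nat * nat) : bool :=
  [|| (a.2 < a.1) && (b.1 < b.2),
      [&& a.1 < a.2, b.1 < b.2, b.1 <= a.1, a.2 <= b.2 & a != b]
    | [&& a.2 < a.1, b.2 < b.1, b.2 <= a.2, a.1 <= b.1 & a != b]].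

Definition interleaved (p q : nat * nat) : bool :=
  (p.1 < q.1 < p.2) && (p.2 < q.2) || (q.1 < p.1 < q.2) && (q.2 < p.2).

(* The segments of the B-diagonal represented by the arrow [a], with the polygon
   vertices numbered 0, ..., 2n+1 and the endpoints in increasing order. *)
Definition chords (n : nat) (a : nat * nat) : seq (nat * nat) :=
  if a.1 < a.2 then [:: (a.2, a.1.+1 + n.+1); (a.1.+1, a.2 + n.+1)]
  else if a.1 == n then [:: (a.2, n.+1); (0, a.2 + n.+1)]
  else [:: (a.2, a.1.+1); (a.2 + n.+1, a.1.+1 + n.+1)].

Lemma forced_lt_backward a b c d : d < a ->
  forced_lt (a, d) (a, b) && forced_lt (a, d) (c, d) =
  ((a < b) || (b < d)) && ((c < d) || (a < c)).
Proof. by rewrite /forced_lt /= !xpair_eqE; lia. Qed.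

Lemma forced_lt_forward a b c d : a < d ->
  forced_lt (a, d) (a, b) && forced_lt (a, d) (c, d) = (d < b) && (c < a).
Proof. by rewrite /forced_lt /= !xpair_eqE; lia. Qed.

(** For four distinct indices, when neither mixed arrow is forced below both [(a, b)] and [(c, d)],
    one of these two is forced below [(a, d)]. Hence stability at [(a, d)] does not depend on the
    choice of order. *)
Lemma forced_lt_total a b c d :
  a != b -> c != d -> a != d -> c != b -> a != c -> b != d ->
  [|| forced_lt (a, d) (a, b) && forced_lt (a, d) (c, d),
      forced_lt (c, b) (c, d) && forced_lt (c, b) (a, b),
      forced_lt (a, b) (a, d) | forced_lt (c, d) (a, d)].
Proof.
move=> ab cd ad cb ac bd.
case: (ltngtP a d) ad => // ad _; case: (ltngtP c b) cb => // cb _.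
all: rewrite ?(forced_lt_forward _ _ ad) ?(forced_lt_backward _ _ ad).
all: rewrite ?(forced_lt_forward _ _ cb) ?(forced_lt_backward _ _ cb).
all: rewrite /forced_lt /= !xpair_eqE.
all: case: (ltngtP a b) ab => // ab _; case: (ltngtP c d) cd => // cd _; lia.
Qed.

Lemma noninterleaved_chordsE n a b c d :
  a <= n -> b <= n -> c <= n -> d <= n -> a != b -> c != d ->
  allrel (fun p q => ~~ interleaved p q) (chords n (a, b)) (chords n (c, d)) =
  ~~ [|| a == d, c == b,
         forced_lt (a, d) (a, b) && forced_lt (a, d) (c, d)
       | forced_lt (c, b) (c, d) && forced_lt (c, b) (a, b)].
Proof.
move=> an bn cn dn ab cd.
have chordsE x y : x <= n -> x != y -> chords n (x, y) =
    if x < y then [:: (y, x.+1 + n.+1); (x.+1, y + n.+1)]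
    else if x < n then [:: (y, x.+1); (y + n.+1, x.+1 + n.+1)]
    else [:: (y, n.+1); (0, y + n.+1)].
  move=> xn _; rewrite /chords /= (ltn_neqAle x n) xn andbT.
  by case: eqP => [->|].
rewrite !chordsE // /allrel /interleaved {chordsE}.
(* Comparisons between the two antipodal halves of the numbering do not depend on the order of the
   indices. *)
have far x : x <= n -> (forall y, x < y + n.+1) * (forall y, (y + n.+1 < x) = false) *
    (forall y, (y + n.+1 < x.+1) = false) * ((n.+1 < x) = false) *
    (forall y, x.+1 < y.+1 + n.+1).
  by move=> xn; do !split=> *; lia.
have farE := (far _ an, far _ bn, far _ cn, far _ dn).
case: (ltngtP a d) => ad; last first.
  (* Up to antipodes, [(a, b)] has a chord running clockwise from [b] to [a + 1], and [(c, a)] one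
     from [a] to [c + 1]. Neither spans more than half the polygon, so these two interleave. *)
  subst d; rewrite /=.
  case: (ltngtP a b) ab => // ab _; last case: (ltngtP a n) an => // an _;
    (case: (ltngtP c a) cd => // ca _; last case: (ltngtP c n) cn => // cn _);
    rewrite /= ?andbT ?ltn_add2r ?ltnS; lia.
all: case: (ltngtP c b) => cb; last first.
1,4: subst c; rewrite orbT /=; case: (ltngtP a b) ab => // ab _;
  last case: (ltngtP a n) an => // an _;
  (case: (ltngtP b d) cd => // bd _; last case: (ltngtP b n) bn => // bn _);
  rewrite /= ?andbT ?ltn_add2r ?ltnS; lia.
all: rewrite ?(forced_lt_forward _ _ ad) ?(forced_lt_backward _ _ ad).
all: rewrite ?(forced_lt_forward _ _ cb) ?(forced_lt_backward _ _ cb).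
all: case: (ltngtP a b) ab => // ab _; last case: (ltngtP a n) an => // an _.
all: case: (ltngtP c d) cd => // cd _; last case: (ltngtP c n) cn => // cn _.
all: rewrite /= ?farE ?andbT ?andbF ?orbF ?andTb ?ltn_add2r ?ltnS; clear farE far.
all: case: (ltngtP a c) => ac //=; case: (ltngtP b d) => bd //=; lia.
Qed.

End ArrowCombinatorics.

(** * Segments between vertices of the polygon *)

Section PolygonGeometry.
Variables (R : realType) (n : nat).
Implicit Types (p q r x y : 'rV[R]_2) (k l m u v w z : nat).

Definition gon k : 'rV[R]_2 :=
  let t := 2 * pi * k%:R / (2 * n.+1)%N%:R in
  \row_(c < 2) (if c == 0 then cos t else - sin t).

(** Twice the signed area of the triangle [p q r], negative when it is traversed clockwise. *)
Definition orient p q r : R :=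
  (q 0 0 - p 0 0) * (r 0 1 - p 0 1) - (q 0 1 - p 0 1) * (r 0 0 - p 0 0).

Lemma rV2P p q : p 0 0 = q 0 0 -> p 0 1 = q 0 1 -> p = q.
Proof.
move=> pq0 pq1; apply/rowP => i.
have [->//|->//] : i = 0 \/ i = 1.
by case: i => [[|[|//]] i2]; [left|right]; apply/val_inj.
Qed.

Lemma orient_affine p q x y (t : R) :
  orient p q (t *: x + (1 - t) *: y) = t * orient p q x + (1 - t) * orient p q y.
Proof. by rewrite /orient !mxE; ring. Qed.

(* With half differences a, b of the angles this is -4 sin a sin b sin (a + b). *)
Lemma orient_gon_lt0 k l m : (k < l)%N -> (l < m)%N -> (m < 2 * n.+1)%N ->
  orient (gon k) (gon l) (gon m) < 0.
Proof.
move=> kl lm mN.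
pose h (i : nat) : R := pi * i%:R / (2 * n.+1)%N%:R.
have N0 : 0 < (2 * n.+1)%N%:R :> R by rewrite ltr0n.
have hD i : 2 * pi * i%:R / (2 * n.+1)%N%:R = h i + h i by rewrite /h; field; lra.
(* Differences of half angles lie strictly between $0$ and $\pi$. *)
have hlt i j : (i < j)%N -> (j < 2 * n.+1)%N -> 0 < sin (h j - h i).
  move=> ij jN; apply: sin_gt0_pi; rewrite /h -mulrBl -mulrBr.
  have ij0 : 0 < j%:R - i%:R :> R by rewrite subr_gt0 ltr_nat.
  have jiN : j%:R - i%:R < (2 * n.+1)%N%:R :> R.
    by rewrite ltrBlDr -natrD ltr_nat; lia.
  rewrite divr_gt0 ?mulr_gt0 ?pi_gt0 //= ltr_pdivrMr // ltr_pM2l ?pi_gt0 //.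
have := hlt _ _ kl (ltn_trans lm mN); have := hlt _ _ lm mN.
have := hlt _ _ (ltn_trans kl lm) mN.
rewrite !sinB /orient /gon !mxE /= !hD !cosD !sinD.
have := cos2Dsin2 (h k); have := cos2Dsin2 (h l); have := cos2Dsin2 (h m).
move: (cos (h k)) (cos (h l)) (cos (h m)) (sin (h k)) (sin (h l)) (sin (h m)).
move=> ck cl cm sk sl sm em el ek s3 s2 s1.
set d := (X in X < 0).
have -> : d = - (4 * ((sm * ck - cm * sk) * (sm * cl - cm * sl) * (sl * ck - cl * sk))).
  rewrite /d.
  have ek' : ck * ck = 1 - sk * sk by rewrite -ek; ring.
  have el' : cl * cl = 1 - sl * sl by rewrite -el; ring.
  have em' : cm * cm = 1 - sm * sm by rewrite -em; ring.
  ring: ek' el' em'.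
rewrite oppr_lt0; do ?apply: mulr_gt0 => //.
Qed.

Lemma orient_gon_out k l m : (k < l)%N -> (l < 2 * n.+1)%N -> (m < 2 * n.+1)%N ->
  (m < k)%N || (l < m)%N -> orient (gon k) (gon l) (gon m) < 0.
Proof.
move=> kl lN mN /orP[mk|lm]; last exact: orient_gon_lt0.
have -> : orient (gon k) (gon l) (gon m) = orient (gon m) (gon k) (gon l).
  by rewrite /orient; ring.
exact: orient_gon_lt0.
Qed.

Lemma orient_gon_in k l m : (k < m < l)%N -> (l < 2 * n.+1)%N ->
  0 < orient (gon k) (gon l) (gon m).
Proof.
move=> /andP[km ml] lN.
have -> : orient (gon k) (gon l) (gon m) = - orient (gon k) (gon m) (gon l).
  by rewrite /orient; ring.
by rewrite oppr_gt0; exact: orient_gon_lt0.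
Qed.

Lemma near_affine_gt0 (a b c : R) x : 0 < a * x 0 0 + b * x 0 1 + c ->
  \forall y \near x, 0 < a * (y : 'rV[R]_2) 0 0 + b * (y : 'rV[R]_2) 0 1 + c.
Proof.
have c0 : {for x, continuous (fun y : 'rV[R]_2 => y 0 0)} by exact: coord_continuous.
have c1 : {for x, continuous (fun y : 'rV[R]_2 => y 0 1)} by exact: coord_continuous.
have cM e i : {for x, continuous (fun y : 'rV[R]_2 => y 0 i)} ->
    {for x, continuous (fun y : 'rV[R]_2 => e * y 0 i)}.
  by move=> ci; apply: (@continuousM R _ (fun=> e)) => //; exact: cst_continuous.
have cf : {for x, continuous (fun y : 'rV[R]_2 => a * y 0 0 + b * y 0 1 + c)}.
  apply: (@continuousD _ _ _ _ (fun=> c)); last exact: cst_continuous.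
  by apply: (@continuousD _ _ _ (fun y : 'rV[R]_2 => a * y 0 0)); exact: cM.
by move=> x0; exact: (cvgr_gt _ cf _ x0).
Qed.

Lemma gon_polygon k : (k < 2 * n.+1)%N -> polygon R n (gon k).
Proof.
move=> kN; apply: sub_hull.
have [kn|kn] := ltnP k n.+1.
  by exists (Ordinal kn, false) => //; rewrite /polygon_point /label_angle /= mul0n addn0.
have kn' : (k - n.+1 < n.+1)%N by lia.
exists (Ordinal kn', true) => //.
by rewrite /polygon_point /label_angle /= mul1n subnK.
Qed.

Lemma polygon_pointE (l : polygon_label n) :
  polygon_point R l = gon (l.1 + l.2 * n.+1).
Proof. by []. Qed.

Lemma dotp_rV2 p q : dotp p q = p 0 0 * q 0 0 + p 0 1 * q 0 1.
Proof. by rewrite /dotp big_ord_recl big_ord1; congr (_ + p 0 _ * q 0 _); apply: val_inj. Qed.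

(** The scalar product with [gon k] is a cosine at each vertex, hence at most $1$ on the polygon,
    and equals $1$ at [gon k]. Stretching [gon k] by any factor above $1$ therefore leaves the
    polygon. *)
Lemma gon_boundary k : ~ (polygon R n)° (gon k).
Proof.
have dot1 x : polygon R n x -> dotp (gon k) x <= 1.
  apply: (@hull_le _ _ _ (dotp (gon k))) => _ [l _ <-].
  rewrite polygon_pointE /= dotp_rV2 !mxE /= mulrNN -cosB.
  exact: cos_le1.
move=> inner.
have near1 : \forall t \near (1 : R), polygon R n (t *: gon k).
  have : (fun t : R => t *: gon k) @ (1 : R) --> 1 *: gon k.
    by apply: cvgZr_tmp; exact: cvg_id.
  by rewrite scale1r; apply.
have /filter_ex[t [tP t1]] : \forall t \near (1 : R)^'+, polygon R n (t *: gon k) /\ 1 < t.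
  near=> t; split; near: t; last exact: nbhs_right_gt.
  exact: cvg_at_right_filter near1.
have := dot1 _ tP; rewrite linearZ /= dotp_rV2 !mxE /= mulrNN -!expr2 cos2Dsin2 mulr1.
by rewrite leNgt t1.
Unshelve. all: by end_near. Qed.

(** The orientation determinants of the four triples are the weights of a common point of the two
    segments. This point has positive weights on all four vertices, and so do all points near it. *)
Lemma gon_segments_cross u v w z :
  (u < w)%N -> (w < v)%N -> (v < z)%N -> (z < 2 * n.+1)%N ->
  hull [set gon u; gon v] `&` hull [set gon w; gon z] `&` (polygon R n)° !=set0.
Proof.
move=> uw wv vz zN.
have [vN wN uN] : [/\ (v < 2 * n.+1)%N, (w < 2 * n.+1)%N & (u < 2 * n.+1)%N] by split; lia.
have := @orient_gon_lt0 w v z wv vz zN; have := @orient_gon_lt0 u v z (ltn_trans uw wv) vz zN.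
have := @orient_gon_lt0 u w z uw (ltn_trans wv vz) zN.
have := @orient_gon_lt0 u w v uw wv vN.
have := gon_polygon zN; have := gon_polygon wN.
have := gon_polygon uN; have := gon_polygon vN.
move: (gon u) (gon v) (gon w) (gon z) => p q r s Pq Pp Pr Ps.
rewrite -oppr_gt0 => d_gt0; rewrite -oppr_gt0 => c_gt0.
rewrite -oppr_gt0 => b_gt0; rewrite -oppr_gt0 => a_gt0.
move: (a_gt0) (b_gt0) (c_gt0) (d_gt0).
(* All four are positive because the clockwise order is [p], [r], [q], [s]. *)
set a := - orient r q s; set b := - orient p q s.
set c := - orient p r s; set d := - orient p r q => a0 b0 c0 d0.
have abcd : a + c = b + d by rewrite /a /b /c /d /orient; ring.
have meet : a *: p + c *: q = b *: r + d *: s.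
  by apply: rV2P; rewrite !mxE /a /b /c /d /orient; ring.
exists ((a + c)^-1 *: (a *: p + c *: q)); split; first split.
- by apply: hull_conic2; rewrite ?ltW ?addr_gt0 //; apply: sub_hull; [left|right].
- rewrite meet abcd.
  by apply: hull_conic2; rewrite ?ltW ?addr_gt0 //; apply: sub_hull; [left|right].
set x := _ *: _.
(* Averaging the two expressions of [x] gives the weights [a * h], [c * h], [b * h], [d * h], with
   sum $1$ since [a + c = b + d]. *)
pose h := (2 * (a + c))^-1.
have h0 : 0 < h by rewrite invr_gt0 mulr_gt0 // addr_gt0.
(* [y - x = al y *: (p - r) + be y *: (q - r)] by Cramer's rule. *)
pose al y := ((y 0 0 - x 0 0) * (q 0 1 - r 0 1) - (y 0 1 - x 0 1) * (q 0 0 - r 0 0)) / d.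
pose be y := ((p 0 0 - r 0 0) * (y 0 1 - x 0 1) - (p 0 1 - r 0 1) * (y 0 0 - x 0 0)) / d.
have d_neq0 : d != 0 by rewrite gt_eqF.
have dE : d = (p 0 0 - r 0 0) * (q 0 1 - r 0 1) - (p 0 1 - r 0 1) * (q 0 0 - r 0 0).
  by rewrite /d /orient; ring.
have ac_neq0 : a + c != 0 by rewrite gt_eqF // addr_gt0.
have xE i : x 0 i = h * (a * p 0 i + c * q 0 i + b * r 0 i + d * s 0 i).
  have : (a *: p + c *: q) 0 i = (b *: r + d *: s) 0 i by rewrite meet.
  by rewrite /x /h !mxE -addrA => <-; field.
(* The displacement from [x] to [y] is absorbed by the weights of [p], [q], [r], without changing
   their sum; the weight of [s] stays fixed. *)
have yE y : y = (a * h + al y) *: p + (c * h + be y) *: q +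
    (b * h - al y - be y) *: r + (d * h) *: s.
  have delta0 : y 0 0 - x 0 0 = al y * (p 0 0 - r 0 0) + be y * (q 0 0 - r 0 0).
    apply: (mulIf d_neq0); rewrite -[RHS](_ : al y * d * (p 0 0 - r 0 0) +
      be y * d * (q 0 0 - r 0 0) = _); last by ring.
    by rewrite /al /be !divfK // dE; ring.
  have delta1 : y 0 1 - x 0 1 = al y * (p 0 1 - r 0 1) + be y * (q 0 1 - r 0 1).
    apply: (mulIf d_neq0); rewrite -[RHS](_ : al y * d * (p 0 1 - r 0 1) +
      be y * d * (q 0 1 - r 0 1) = _); last by ring.
    by rewrite /al /be !divfK // dE; ring.
  apply: rV2P; rewrite !mxE.
    by rewrite -[LHS](subrK (x 0 0)) delta0 xE; ring.
  by rewrite -[LHS](subrK (x 0 1)) delta1 xE; ring.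
have al0 : al x = 0 by rewrite /al !subrr !mul0r subrr mul0r.
have be0 : be x = 0 by rewrite /be !subrr !mulr0 subrr mul0r.
have [[[a1 a2] a3] /= alE] : exists e, forall y, al y = e.1.1 * y 0 0 + e.1.2 * y 0 1 + e.2.
  exists ((q 0 1 - r 0 1) / d, - (q 0 0 - r 0 0) / d,
    (x 0 1 * (q 0 0 - r 0 0) - x 0 0 * (q 0 1 - r 0 1)) / d) => y.
  by rewrite /al /=; ring.
have [[[b1 b2] b3] /= beE] : exists e, forall y, be y = e.1.1 * y 0 0 + e.1.2 * y 0 1 + e.2.
  exists (- (p 0 1 - r 0 1) / d, (p 0 0 - r 0 0) / d,
    (x 0 0 * (p 0 1 - r 0 1) - x 0 1 * (p 0 0 - r 0 0)) / d) => y.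
  by rewrite /be /=; ring.
have near_affine (f : 'rV[R]_2 -> R) :
    (exists e, forall y, f y = e.1.1 * y 0 0 + e.1.2 * y 0 1 + e.2) -> 0 < f x ->
    \forall y \near x, 0 < f y.
  by move=> [e fE]; rewrite fE => /near_affine_gt0; apply: filterS => y; rewrite fE.
have nA : \forall y \near x, 0 < a * h + al y.
  apply: near_affine; last by rewrite al0 addr0 mulr_gt0.
  by exists (a1, a2, a * h + a3) => y /=; rewrite alE; ring.
have nC : \forall y \near x, 0 < c * h + be y.
  apply: near_affine; last by rewrite be0 addr0 mulr_gt0.
  by exists (b1, b2, c * h + b3) => y /=; rewrite beE; ring.
have nB : \forall y \near x, 0 < b * h - al y - be y.
  apply: near_affine; last by rewrite al0 be0 !subr0 mulr_gt0.
  by exists (- a1 - b1, - a2 - b2, b * h - a3 - b3) => y /=; rewrite alE beE; ring.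
apply: filterS3 nA nC nB => y A0 C0 B0.
rewrite (yE y); apply: hull_conic4 => //; first exact: mulr_gt0.
have -> : a * h + al y + (c * h + be y) + (b * h - al y - be y) + d * h =
  (a + c + (b + d)) * h by ring.
by rewrite -abcd /h; field.
Qed.

(** Orientation relative to the line through [gon u] and [gon v] vanishes at a common point [x]. As
    [x] is interior it is no vertex, so the values at [gon w] and [gon z] have opposite signs or are
    both zero: the chords are interleaved or equal. *)
Lemma gon_segments_disjoint u v w z :
  (u < v)%N -> (w < z)%N -> (v < 2 * n.+1)%N -> (z < 2 * n.+1)%N ->
  (u, v) != (w, z) -> ~~ interleaved (u, v) (w, z) ->
  ~ (hull [set gon u; gon v] `&` hull [set gon w; gon z] `&` (polygon R n)° !=set0).
Proof.
move=> uv wz vN zN neq; rewrite /interleaved /= => nint.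
move=> [x [[/hull_segment[s s01 xs] /hull_segment[t /andP[t0 t1] xt]] inner]].
pose f := orient (gon u) (gon v).
have fx : f x = 0.
  by rewrite /f xs orient_affine /orient; ring.
have fwz : t * f (gon w) + (1 - t) * f (gon z) = 0 by rewrite -fx /f xt orient_affine.
have [tz|tz] := eqVneq t 0.
  by apply: (@gon_boundary z); move: inner; rewrite xt tz scale0r add0r subr0 scale1r.
have [tw|tw] := eqVneq t 1.
  by apply: (@gon_boundary w); move: inner; rewrite xt tw subrr scale0r addr0 scale1r.
have {}t0 : 0 < t by rewrite lt_neqAle eq_sym tz.
have {}t1 : 0 < 1 - t by rewrite subr_gt0 lt_neqAle tw.
have f_in m : (u < m < v)%N -> 0 < f (gon m) by move=> umv; exact: orient_gon_in.
have f_out m : (m < 2 * n.+1)%N -> (m < u)%N || (v < m)%N -> f (gon m) < 0.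
  by move=> mN; exact: orient_gon_out.
have f_end m : (m == u) || (m == v) -> f (gon m) = 0.
  by case/orP => /eqP->; rewrite /f /orient; ring.
have mP m : (m < 2 * n.+1)%N -> [\/ (u < m < v)%N /\ 0 < f (gon m),
    ((m < u)%N || (v < m)%N) /\ f (gon m) < 0 |
    ((m == u) || (m == v)) /\ f (gon m) = 0].
  move=> mN; have [umv|] := boolP (u < m < v)%N.
    by constructor 1; split=> //; exact: f_in.
  have [mout|] := boolP ((m < u)%N || (v < m)%N).
    by constructor 2; split=> //; exact: f_out.
  move=> m_nout m_nin; have e : (m == u) || (m == v) by lia.
  by constructor 3; split=> //; exact: f_end.
have [[wi fw]|[wi fw]|[wi fw]] := mP w (ltn_trans wz zN);
  have [[zi fz]|[zi fz]|[zi fz]] := mP z zN;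
  first [by nra | move: neq; rewrite xpair_eqE; lia].
Qed.

End PolygonGeometry.

(** * B-diagonals and arrows *)

Section TypeBDiagonals.
Variables (R : realType) (n : nat).
Implicit Types (d : Bdiagonal n) (a b : 'I_n.+1 * 'I_n.+1).

Lemma val_ord_pred (i : 'I_n.+1) : ord_pred i = (if i == 0 :> nat then n else i.-1) :> nat.
Proof.
have := ltn_ord i; case: (i) => [[|k] kn] /= ki; first by rewrite modn_small.
by rewrite modnDr modn_small //; lia.
Qed.

(** The pairs of polygon sides left out of [BSame] and [BOpp] are exactly those that would give
    loops. *)
Lemma arrow_rep_neq d : (0 < n)%N -> (arrow_rep d).1 != (arrow_rep d).2.
Proof.
by move=> n0; case: d => [i|i j ij|i j /andP[ji ij]] /=;
  apply/eqP => /(congr1 (@nat_of_ord _)); rewrite val_ord_pred;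
  have := ltn_ord i; try have := ltn_ord j; case: ifP; lia.
Qed.

(** The head gives [i] and the cyclic successor of the tail gives [j]; the constructor is read off
    from the comparison of [i] with [j], equality being the diameter. *)
Lemma arrow_rep_inj : injective (@arrow_rep n).
Proof.
have neqS (i j : 'I_n.+1) : (i < j)%N -> ord_pred i = ord_pred j :> 'I_n.+1 -> False.
  by move=> ij /ord_pred_inj e; rewrite e ltnn in ij.
move=> [i|i j ij|i j ij] [k|k l kl|k l kl] e;
  have /= e1 := congr1 fst e; have /= e2 := congr1 snd e; subst.
- by [].
- by case: (neqS _ _ (ltnW kl)).
- by have /andP[lk _] := kl; case: (neqS _ _ lk).
- by case: (neqS _ _ (ltnW ij)).
- by move/ord_pred_inj: e1 => e'; subst; congr BSame; exact: bool_irrelevance.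
- have /andP[lk _] := kl; case: (neqS _ _ (ltn_trans lk (ltnW ij))).
  by rewrite e1.
- by have /andP[ji _] := ij; case: (neqS _ _ ji).
- have /andP[ji _] := ij; case: (neqS _ _ (ltn_trans ji (ltnW kl))).
  by rewrite e1.
by move/ord_pred_inj: e1 => e'; subst; congr BOpp; exact: bool_irrelevance.
Qed.

Lemma arrow_rep_surj a : a.1 != a.2 -> exists d, arrow_rep d = a.
Proof.
case: a => x y /= xy.
have [ji|ij|ij] := ltngtP (ordS x) y.
(* The excluded case would make both [x] and [y] equal to [n]. *)
- have h : (ordS x < y)%N && ~~ ((ordS x == 0 :> nat) && (y == n :> nat)).
    rewrite ji /=; apply: contraNN xy => /andP[/eqP x0 /eqP yn].
    have : ordS x = ord0 by apply: val_inj.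
    move/(congr1 (@ord_pred _)); rewrite ordSK => ->; apply/eqP/val_inj.
    by rewrite [LHS]val_ord_pred; exact: esym yn.
  by exists (BOpp h); rewrite /= ordSK.
- have h : (y.+1 < ordS x)%N.
    rewrite ltn_neqAle ij andbT; apply: contraNneq xy => yx.
    apply/eqP; rewrite -(ordSK x); apply: val_inj.
    by rewrite [LHS]val_ord_pred -yx.
  by exists (BSame h); rewrite /= ordSK.
by exists (BDiameter y); rewrite /= -(ordSK x); congr (ord_pred _, _); apply: val_inj.
Qed.

Definition label_number (l : polygon_label n) : nat := (l.1 + l.2 * n.+1)%N.

Definition segment_numbers (s : polygon_label n * polygon_label n) : nat * nat :=
  (minn (label_number s.1) (label_number s.2), maxn (label_number s.1) (label_number s.2)).

Definition nat_arrow a : nat * nat := (nat_of_ord a.1, nat_of_ord a.2).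

(** Only membership is compared, because [chords] lists a diameter twice. *)
Lemma segment_numbersP d :
  [seq segment_numbers s | s <- Bsegments d] =i chords n (nat_arrow (arrow_rep d)).
Proof.
move=> q; rewrite /chords /segment_numbers /label_number /nat_arrow.
case: d => [i|i j ij|i j ij]; rewrite /arrow_rep;
  [have := val_ord_pred i; move: (ord_pred i)|have := val_ord_pred j; move: (ord_pred j)
  |have := val_ord_pred j; move: (ord_pred j)] => t;
  rewrite /= => ->; rewrite ?mul0n ?mul1n ?addn0.
- have := ltn_ord i; have [->|i0] := eqVneq (nat_of_ord i) 0%N => iN /=.
    by rewrite eqxx /minn /maxn !inE orbb.
  have -> : (i.-1 < i)%N by lia.
  have -> : minn i (i + n.+1) = i by lia.
  have -> : maxn i (i + n.+1) = (i + n.+1)%N by lia.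
  by rewrite prednK ?lt0n // !inE orbb.
- have jN := ltn_ord j; have -> : (j == 0 :> nat) = false by apply/eqP; lia.
  have -> : (j.-1 < i)%N = false by apply/negbTE; lia.
  have -> : (j.-1 == n)%N = false by apply/negbTE; lia.
  by rewrite prednK; [congr (_ \in [:: (_, _); (_, _)]); lia|lia].
have iN := ltn_ord i; have /andP[ji ijn] := ij.
have [j0|j0] := eqVneq (nat_of_ord j) 0%N.
  have -> : (n < i)%N = false by apply/negbTE; lia.
  by rewrite eqxx; congr (_ \in [:: (_, _); (_, _)]); lia.
have -> : (j.-1 < i)%N by lia.
by rewrite prednK; [congr (_ \in [:: (_, _); (_, _)]); lia|lia].
Qed.

Lemma label_number_lt (l : polygon_label n) : (label_number l < 2 * n.+1)%N.
Proof. by case: l => i [] /=; rewrite /label_number /=; have := ltn_ord i; lia. Qed.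

Lemma segment_gon (s : polygon_label n * polygon_label n) :
  segment R s = hull [set gon R n (segment_numbers s).1; gon R n (segment_numbers s).2].
Proof.
rewrite /segment !polygon_pointE /segment_numbers -!/(label_number _) /=.
by case: ltnP => _ //; rewrite setUC.
Qed.

Lemma Bsegments_numbers_lt d s : s \in Bsegments d ->
  ((segment_numbers s).1 < (segment_numbers s).2)%N.
Proof.
rewrite /segment_numbers /label_number.
case: d => [i|i j ij|i j ij]; rewrite /= ?inE;
  [move=> /eqP->|move=> /orP[]/eqP->|case/andP: (ij) => ji _ /orP[]/eqP->] => /=;
  try have := ltn_ord i; try have := ltn_ord j; lia.
Qed.

(** Ensures that distinct $B$-diagonals share no segment, as a segment would meet itself without
    being interleaved with itself. *)
Lemma chords_inj a b q : a.1 != a.2 -> b.1 != b.2 ->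
  q \in chords n (nat_arrow a) -> q \in chords n (nat_arrow b) -> a = b.
Proof.
case: a b q => [a1 a2] [b1 b2] [u v]; rewrite -!val_eqE /nat_arrow /chords /= => a12 b12.
have := ltn_ord a1; have := ltn_ord a2; have := ltn_ord b1; have := ltn_ord b2.
move=> ? ? ? ? qa qb; suff [e1 e2] : (a1 = b1 :> nat) /\ (a2 = b2 :> nat).
  by congr (_, _); apply: val_inj.
move: qa qb; do 2![case: ifP => ?]; rewrite ?inE; try case: ifP => ?; try case: ifP => ?;
  rewrite ?inE !xpair_eqE; lia.
Qed.

Lemma cross_chords d1 d2 : (0 < n)%N -> arrow_rep d1 <> arrow_rep d2 ->
  cross R d1 d2 <->
  ~~ allrel (fun p q => ~~ interleaved p q) (chords n (nat_arrow (arrow_rep d1)))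
       (chords n (nat_arrow (arrow_rep d2))).
Proof.
move=> n0 d12; split=> [[s1 [s2 [s1d s2d]]]|].
  rewrite !segment_gon => meet; apply/negP => /allrelP nint.
  have c1 : segment_numbers s1 \in chords n (nat_arrow (arrow_rep d1)).
    by rewrite -segment_numbersP map_f.
  have c2 : segment_numbers s2 \in chords n (nat_arrow (arrow_rep d2)).
    by rewrite -segment_numbersP map_f.
  have := nint _ _ c1 c2; move: (Bsegments_numbers_lt s1d) (Bsegments_numbers_lt s2d).
  move=> lt1 lt2 nint12; apply: gon_segments_disjoint meet => //.
  - by rewrite /segment_numbers /= gtn_max !label_number_lt.
  - by rewrite /segment_numbers /= gtn_max !label_number_lt.
  - apply/eqP => s12; apply: d12; apply: chords_inj c1 _; rewrite ?arrow_rep_neq //.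
    by rewrite (surjective_pairing (segment_numbers s1)) s12 -surjective_pairing.
move=> /allPn[p pc /allPn[q qc /negPn]].
move: pc qc; rewrite -!segment_numbersP => /mapP[s1 s1d ->] /mapP[s2 s2d ->] int12.
exists s1, s2; split=> //; rewrite !segment_gon.
have N1 : ((segment_numbers s1).2 < 2 * n.+1)%N.
  by rewrite /segment_numbers /= gtn_max !label_number_lt.
have N2 : ((segment_numbers s2).2 < 2 * n.+1)%N.
  by rewrite /segment_numbers /= gtn_max !label_number_lt.
case/orP: int12 => /andP[/andP[lt1 lt2] lt3].
  exact: gon_segments_cross lt1 lt2 lt3 N2.
by rewrite [X in X `&` _]setIC; exact: gon_segments_cross lt1 lt2 lt3 N1.
Qed.

End TypeBDiagonals.

(** * Noncrossing sets of $B$-diagonals and simplices of the pulling triangulation *)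

Theorem theorem6p1 (R : realType) (n : nat) (n_ge1 : (1 <= n)%N)
    (lt : 'rV[R]_n.+1 -> 'rV[R]_n.+1 -> Prop)
    (lt_order : strict_linear_order_on (vertices (legendre_polytope R n)) lt)
    (lt1 : forall x1 y1 x2 y2 : 'I_n.+1,
       (y1 < x1)%N -> (x2 < y2)%N ->
       lt (arrow_point R (x1, y1)) (arrow_point R (x2, y2)))
    (lt2 : forall x1 y1 x2 y2 : 'I_n.+1,
       (x1, y1) <> (x2, y2) -> (x1 < y1)%N -> (x2 < y2)%N ->
       ord_interval x1 y1 \subset ord_interval x2 y2 ->
       lt (arrow_point R (x1, y1)) (arrow_point R (x2, y2)))
    (lt3 : forall x1 y1 x2 y2 : 'I_n.+1,
       (x1, y1) <> (x2, y2) -> (y1 < x1)%N -> (y2 < x2)%N ->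
       ord_interval y1 x1 \subset ord_interval y2 x2 ->
       lt (arrow_point R (x1, y1)) (arrow_point R (x2, y2))) :
  set_bij [set: Bdiagonal n] (vertices (legendre_polytope R n))
    (fun d => arrow_point R (arrow_rep d)) /\
  forall S : set (Bdiagonal n),
    associahedron_face R S <->
    exists T : set 'rV[R]_n.+1,
      pulling lt (boundary_complex (legendre_polytope R n)) T /\
      vertices T = [set arrow_point R (arrow_rep d) | d in S].
Proof.
have rep_neq d := @arrow_rep_neq n d n_ge1.
split.
  rewrite vertices_polytope; split=> [d _|d1 d2 _ _|_ [a a12 <-]].
  - by exists (arrow_rep d) => //; exact: rep_neq.
  - by move/(arrow_point_inj (rep_neq d1))/arrow_rep_inj.
  - by have [d <-] := arrow_rep_surj a12; exists d.
have ltP (a b : 'I_n.+1 * 'I_n.+1) : forced_lt (nat_arrow a) (nat_arrow b) ->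
    lt (arrow_point R a) (arrow_point R b).
  case: a b => [a1 a2] [b1 b2]; rewrite /nat_arrow.
  case/or3P => /= [/andP[]||]; first exact: lt1.
    move=> /and5P[a12 b12 ba ab /eqP neq]; apply: lt2 => //.
      by move=> [e1 e2]; apply: neq; rewrite e1 e2.
    by apply/fintype.subsetP => k; rewrite !inE => /andP[ak ka]; lia.
  move=> /and5P[a12 b12 ba ab /eqP neq]; apply: lt3 => //.
    by move=> [e1 e2]; apply: neq; rewrite e1 e2.
  by apply/fintype.subsetP => k; rewrite !inE => /andP[ak ka]; lia.
have chordsE (a b : 'I_n.+1 * 'I_n.+1) : a.1 != a.2 -> b.1 != b.2 ->
    allrel (fun p q => ~~ interleaved p q) (chords n (nat_arrow a)) (chords n (nat_arrow b)) =
    ~~ [|| a.1 == b.2, b.1 == a.2,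
           forced_lt (nat_arrow (a.1, b.2)) (nat_arrow a) &&
           forced_lt (nat_arrow (a.1, b.2)) (nat_arrow b)
         | forced_lt (nat_arrow (b.1, a.2)) (nat_arrow b) &&
           forced_lt (nat_arrow (b.1, a.2)) (nat_arrow a)].
  move=> a12 b12; exact: (@noninterleaved_chordsE n a.1 a.2 b.1 b.2 (ltn_ord a.1)
    (ltn_ord a.2) (ltn_ord b.1) (ltn_ord b.2) a12 b12).
have DB : @box_complex n (@is_box n) by split.
rewrite (boundary_polytope R n_ge1) => S; split=> [noncross|[T []]].
  pose G : {set 'I_n.+1 * 'I_n.+1} := [set a | `[< exists2 d, S d & arrow_rep d = a >]]%SET.
  have inG (a : 'I_n.+1 * 'I_n.+1) : a \in G <-> exists2 d, S d & arrow_rep d = a.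
    by rewrite inE; split => [/asboolP|?]; [|apply/asboolP].
  have Gneq (a : 'I_n.+1 * 'I_n.+1) : a \in G -> a.1 != a.2.
    by move=> /inG[d _ <-]; exact: rep_neq.
  have compat (a b : 'I_n.+1 * 'I_n.+1) : a \in G -> b \in G -> a <> b ->
      allrel (fun p q => ~~ interleaved p q) (chords n (nat_arrow a)) (chords n (nat_arrow b)).
    move=> /inG[d1 S1 <-] /inG[d2 S2 <-] d12.
    apply: contrapT => /negP /(cross_chords R n_ge1 d12).
    by apply: noncross => // e; apply: d12; rewrite e.
  (* An index serving as a tail of one arrow and a head of another would make their $B$-diagonals
     cross. *)
  have bG : is_box (carrier G).
    exists (tails G), (heads G); split=> //.
    rewrite disjoint_subset; apply/fintype.subsetP => _ /imsetP[a aG ->]; rewrite inE.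
    apply/negP => /imsetP[b bG ab]; have [e|/eqP neq] := eqVneq a b.
      by have := Gneq _ bG; rewrite -ab e eqxx.
    by have := compat _ _ aG bG neq; rewrite chordsE ?Gneq // ab eqxx.
  have sG : stable lt G.
    move=> a b aG bG' [lta ltb].
    have aX := fintype.subsetP (sub_carrier G) _ aG.
    have bX := fintype.subsetP (sub_carrier G) _ bG'.
    have cX := box_mix bG aX bX; have c12 := box_neq bG cX.
    have irr (c : 'I_n.+1 * 'I_n.+1) : c \in carrier G ->
        ~ lt (arrow_point R c) (arrow_point R c).
      move=> cX'. exact: (ltp_irr lt_order (box_neq bG cX')).
    have asym (c : 'I_n.+1 * 'I_n.+1) : c \in carrier G ->
        lt (arrow_point R c) (arrow_point R (a.1, b.2)) ->
        lt (arrow_point R (a.1, b.2)) (arrow_point R c) -> False.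
      move=> cX' l1 l2; apply: (irr _ cX'); apply: (ltp_trans lt_order) l1 l2 => //;
        exact: box_neq cX'.
    have [e|/eqP neq] := eqVneq a b.
      by apply: (irr _ aX); move: lta; rewrite e -surjective_pairing.
    (* With a common tail or head the mixed arrow is one of the two arrows and would precede itself.
       Otherwise all four endpoints are distinct and [forced_lt_total] applies. *)
    have [e1|a1b1] := eqVneq a.1 b.1.
      by apply: (irr _ bX); move: ltb; rewrite e1 -surjective_pairing.
    have [e2|a2b2] := eqVneq a.2 b.2.
      by apply: (irr _ aX); move: lta; rewrite -e2 -surjective_pairing.
    have := compat _ _ aG bG' neq; rewrite chordsE ?Gneq // !negb_or.
    move=> /and4P[ab ba nf1 nf2].
    have := forced_lt_total (Gneq _ aG) (Gneq _ bG') ab ba a1b1 a2b2.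
    rewrite (negPf nf1) (negPf nf2) /= => /orP[f|f].
    - by apply: (asym _ aX) lta; exact: (ltP a (a.1, b.2)).
    - by apply: (asym _ bX) ltb; exact: (ltP b (a.1, b.2)).
  exists (@cell R n G); split.
    exact: (pulling_of_stable lt_order DB bG (sub_carrier G) sG).
  rewrite (vertices_cell R bG (sub_carrier G)); apply/seteqP.
  split=> [_ [a /= /inG[d Sd <-] <-]|_ [d Sd <-]]; first by exists d.
  by exists (arrow_rep d) => //; apply/inG; exists d.
move=> /(stable_of_pulling lt_order DB)[X [G [bX GX sG ->]]].
rewrite (vertices_cell R bX GX) => GS.
have inG d : S d -> arrow_rep d \in G.
  move=> Sd; have : [set arrow_point R (arrow_rep d) | d in S] (arrow_point R (arrow_rep d)).
    by exists d.
  by rewrite -GS => -[a aG] /esym/(arrow_point_inj (rep_neq d)) ->.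
move=> d1 d2 S1 S2 d12.
have d12' : arrow_rep d1 <> arrow_rep d2 by move/arrow_rep_inj.
move=> /(cross_chords R n_ge1 d12'); rewrite chordsE // negbK.
have aG := inG _ S1; have bG := inG _ S2.
move: (arrow_rep d1) (arrow_rep d2) aG bG => a b aG bG.
have aX := fintype.subsetP GX _ aG; have bX' := fintype.subsetP GX _ bG.
have abX := box_mix bX aX bX'; have baX := box_mix bX bX' aX.
(* A crossing yields either a loop among the mixed arrows, which lie in the box [X], or a mixed
   arrow preceding both arrows, against stability. *)
move=> /or4P[||/andP[f1 f2]|/andP[f1 f2]].
- by apply/negP; exact: box_neq abX.
- by apply/negP; exact: box_neq baX.
- by apply: (sG _ _ aG bG); split; [exact: (ltP (a.1, b.2) a)|exact: (ltP (a.1, b.2) b)].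
- by apply: (sG _ _ bG aG); split; [exact: (ltP (b.1, a.2) b)|exact: (ltP (b.1, a.2) a)].
Qed.
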